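(* Consider the convex program $\min_{x\in X} f_0(x)$ s.t. $Ax=b$, $f_i(x)\le 0$, $i=1,\dots,m$, with $f_0=g+h$, under the standing assumptions in the context. Fix a positive integer $K$ and numbers $C_\beta>0$, $C_\varepsilon>0$ and, for settings 2 and 3, $\sigma>1$. For a given $\varepsilon>0$, let $\{(x^k,y^k,z^k)\}_{k=0}^{K}$ be generated by the inexact augmented Lagrangian method (iALM, see context) with $y^0=0$, $z^0=0$ and parameters set according to one of the following (for $0\le k<K$): 1. $\rho_k=\beta_k=\frac{C_\beta}{K\varepsilon}$ and $\varepsilon_k=\frac{\varepsilon}{2}\frac{C_\varepsilon}{C_\beta}$. 2. $\rho_k=\beta_k=\beta_g\sigma^k$, with $\beta_g>0$ such that $\sum_{k=0}^{K-1}\beta_k=\frac{C_\beta}{\varepsilon}$, and $\varepsilon_k=\frac{\varepsilon}{2}\frac{C_\varepsilon}{C_\beta}$. 3. $\rho_k=\beta_k=\beta_g\sigma^k$, with $\beta_g>0$ such that $\sum_{k=0}^{K-1}\beta_k=\frac{C_\beta}{\varepsilon}$; and $\varepsilon_k=\frac{C_\varepsilon}{2\beta_k^{1/3}}\frac{1}{\sum_{t=0}^{K-1}\beta_t^{2/3}}$ in the convex case, $\varepsilon_k=\frac{C_\varepsilon}{2\beta_k^{1/2}}\frac{1}{\sum_{t=0}^{K-1}\beta_t^{1/2}}$ in the strongly convex case. Then: (a) The averaged point $\bar x^K=\sum_{k=0}^{K-1}\frac{\rho_k x^{k+1}}{\sum_{t=0}^{K-1}\rho_t}$ is an $O(\varepsilon)$-optimal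 solution, where the hidden constant depends on $C_\beta$, $C_\varepsilon$ and the dual solution $(y^*,z^* )$. (b) In settings 2 and 3, when there are no affine equality constraints (any affine equality being written as two affine inequalities), the actual iterate $x^K$ is also an $O(\varepsilon)$-optimal solution (with a hidden constant that may also depend on $\sigma$). (c) When every subproblem is solved by Nesterov's optimal first-order method as described in the context, the total number of evaluations of $\nabla g$ and $\nabla f_i$, $i=1,\dots,m$, is $O(\varepsilon^{-1})$ in the convex case and $O(\varepsilon^{-1/2}|\log\varepsilon|)$ in the strongly convex case, as $\varepsilon\to0$ with the problem data, $K$, $C_\beta$, $C_\varepsilon$, $\sigma$ and the initial point fixed.
   Context: Notation: $\|\cdot\|$ is the Euclidean norm; $[a]_+=\max(0,a)$ componentwise; $f(x)=(f_1(x),\dots,f_m(x))$. Standing assumptions: $X\subseteq\mathbb R^n$ is closed and convex, $A$ is a matrix, $b$ a vector; $f_0=g+h$ with $g$ convex differentiable and $h:\mathbb R^n\to\mathbb R\cup\{+\infty\}$ convex; $f_1,\dots,f_m$ are convex and differentiable; there are constants $L_0,\dots,L_m$ with $\|\nabla g(\hat x)-\nabla g(\tilde x)\|\le L_0\|\hat x-\tilde x\|$ and $\|\nabla f_i(\hat x)-\nabla f_i(\tilde x)\|\le L_i\|\hat x-\tilde x\|$ for all $\hat x,\tilde x\in \mathrm{dom}(h)\cap X$; $\mathrm{dom}(h)\cap X$ is bounded. There is a point $(x^*,y^*,z^* )$ satisfying the KKT conditions: $0\in\partial f_0(x^* )+N_X(x^* )+A^\top y^*+\sum_i z_i^*\nabla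 f_i(x^* )$ ($N_X$ the normal cone), $Ax^*=b$, $x^*\in X$, $z_i^*\ge0$, $f_i(x^* )\le0$, $z_i^*f_i(x^* )=0$ for all $i$. ''Convex case'' means no strong convexity is assumed ($\mu=0$). ''Strongly convex case'' means that $g$ is strongly convex with a known modulus $\mu\in(0,L_0/4]$. $\varepsilon$-optimal solution: $x\in X$ with $|f_0(x)-f_0^*|\le\varepsilon$ and $\|Ax-b\|+\|[f(x)]_+\|\le\varepsilon$, where $f_0^*$ is the optimal value. ''$O(\varepsilon)$-optimal'' means $c\,\varepsilon$-optimal with a constant $c$ independent of $\varepsilon$. Augmented Lagrangian: $\mathcal L_\beta(x,y,z)=f_0(x)+y^\top(Ax-b)+\frac\beta2\|Ax-b\|^2+\sum_{i=1}^m\psi_\beta(f_i(x),z_i)$, where $\psi_\beta(u,v)=uv+\frac\beta2u^2$ if $\beta u+v\ge0$ and $\psi_\beta(u,v)=-\frac{v^2}{2\beta}$ if $\beta u+v<0$. iALM: from $x^0\in\mathrm{dom}(h)\cap X$, $y^0,z^0$, for $k=0,1,\dots$: find $x^{k+1}\in X$ with $\mathcal L_{\beta_k}(x^{k+1},y^k,z^k)\le\min_{x\in X}\mathcal L_{\beta_k}(x,y^k,z^k)+\varepsilon_k$ (such a point is assumed to exist for every $k$); set $y^{k+1}=y^k+\rho_k(Ax^{k+1}-b)$ and $z_i^{k+1}=z_i^k+\rho_k\max\big(-\frac{z_i^k}{\beta_k},f_i(x^{k+1})\big)$, $i=1,\dots,m$. Subproblem solver (Nesterov's optimal first-order method): to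 minimize $\phi+\psi$ with $\phi$ convex differentiable with gradient Lipschitz constant $L_\phi$ and strong convexity modulus $\mu\ge0$, start from $\hat w^0=w^0$, $\alpha_0=1$ if $\mu=0$ and $\alpha_0=\sqrt{\mu/L_\phi}$ if $\mu>0$, $q=\mu/L_\phi$, and iterate $w^{j+1}=\arg\min_w\langle\nabla\phi(\hat w^j),w\rangle+\frac{L_\phi}2\|w-\hat w^j\|^2+\psi(w)$, $\alpha_{j+1}=\frac{q-\alpha_j^2+\sqrt{(q-\alpha_j^2)^2+4\alpha_j^2}}2$, $\hat w^{j+1}=w^{j+1}+\frac{\alpha_j(1-\alpha_j)}{\alpha_j^2+\alpha_{j+1}}(w^{j+1}-w^j)$. In the $k$-th iALM iteration it is started at $w^0=x^k$ with $\phi=\mathcal L_{\beta_k}(\cdot,y^k,z^k)-h$, $\psi=h+\iota_X$ ($\iota_X$ the indicator function of $X$), and $L_\phi=L_0+\beta_k\|A^\top A\|+\sum_{i=1}^m(\beta_kB_i(B_i+L_i)+L_i|z_i^k|)$, where $B_i$ are constants with $\max(|f_i(x)|,\|\nabla f_i(x)\|)\le B_i$ and $|f_i(\hat x)-f_i(\tilde x)|\le B_i\|\hat x-\tilde x\|$ on $\mathrm{dom}(h)\cap X$; it is stopped once the accuracy $\varepsilon_k$ is reached. Each iteration uses one evaluation of the gradients $\nabla g,\nabla f_1,\dots,\nabla f_m$.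
   Formalization: In (c) it is additionally assumed that ∇φ is L_φ-Lipschitz on some convex set containing dom(h)∩X and the extrapolated points ŵ^j; with the Lipschitz bounds only on dom(h)∩X, the method can cycle forever and (c) fails. *)

(* Defs.v *)
From mathcomp Require Import all_boot all_order all_algebra.
From mathcomp Require Import all_classical all_reals all_analysis.

Set Implicit Arguments.
Unset Strict Implicit.
Unset Printing Implicit Defensive.

Import Order.TTheory GRing.Theory Num.Theory.
Import numFieldNormedType.Exports.

Local Open Scope classical_set_scope.
Local Open Scope ring_scope.

Section Euclidean.
Context {R : realType}.

Definition dot {n : nat} (u v : 'cV[R]_n) : R := (u^T *m v) ord0 ord0.

(* The library norm on matrices is the sup norm (same topology, same bounded
   sets), hence a separate Euclidean norm. *)
Definition enorm {n : nat} (u : 'cV[R]_n) : R := Num.sqrt (dot u u).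

Definition opnorm {m n : nat} (M : 'M[R]_(m, n)) : R :=
  sup [set enorm (M *m u) | u in [set u : 'cV[R]_n | enorm u <= 1]].

Definition grad {n : nat} (f : 'cV[R]_n -> R^o) (x : 'cV[R]_n) : 'cV[R]_n :=
  \col_i ('d f x (delta_mx i ord0) : R).

Definition lipschitz_grad {n : nat} (D : set 'cV[R]_n) (L : R)
    (f : 'cV[R]_n -> R^o) : Prop :=
  forall x y, D x -> D y -> enorm (grad f x - grad f y) <= L * enorm (x - y).

Definition strongly_convex {n : nat} (mu : R) (f : 'cV[R]_n -> R^o) : Prop :=
  forall (x y : 'cV[R]_n) (t : R), 0 <= t <= 1 ->
    f (t *: x + (1 - t) *: y) <=
      t * f x + (1 - t) * f y - mu / 2 * (t * (1 - t)) * enorm (x - y) ^+ 2.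

(* Intended for functions that never take the value -oo, so that no
   undefined sum occurs (and 0 * +oo = 0 handles t = 0, 1). *)
Definition econvex {n : nat} (h : 'cV[R]_n -> \bar R) : Prop :=
  forall (x y : 'cV[R]_n) (t : R), 0 <= t <= 1 ->
    (h (t *: x + (1 - t) *: y)%R <= t%:E * h x + (1 - t)%:E * h y)%E.

Definition subdiff {n : nat} (F : 'cV[R]_n -> \bar R) (x : 'cV[R]_n) :
    set 'cV[R]_n :=
  [set u | F x \is a fin_num /\
           forall v, (F x + (dot u (v - x)%R)%:E <= F v)%E].

Definition normal_cone {n : nat} (X : set 'cV[R]_n) (x : 'cV[R]_n) :
    set 'cV[R]_n :=
  [set u | forall v, X v -> dot u (v - x) <= 0].

Definition eindic {n : nat} (X : set 'cV[R]_n) (x : 'cV[R]_n) : \bar R :=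
  if x \in X then 0%E else +oo%E.

End Euclidean.

(* min g x + h x  s.t.  x in X, A x = b, f_i x <= 0. *)
Record cvxprog (R : realType) (n p m : nat) := CvxProg {
  cX : set 'cV[R]_n;
  cA : 'M[R]_(p, n);
  cb : 'cV[R]_p;
  cg : 'cV[R]_n -> R^o;
  ch : 'cV[R]_n -> \bar R;
  cf : 'I_m -> 'cV[R]_n -> R^o
}.

Section ConvexProgram.
Context {R : realType} {n p m : nat}.
Variable P : cvxprog R n p m.
Implicit Types (x u : 'cV[R]_n) (y : 'cV[R]_p) (z : 'cV[R]_m).

Definition obj x : \bar R := ((cg P x)%:E + ch P x)%E.

Definition cdom : set 'cV[R]_n := [set x | (ch P x < +oo)%E] `&` cX P.

Definition feasible : set 'cV[R]_n :=
  [set x | [/\ cX P x, cA P *m x = cb P & forall i, cf P i x <= 0]].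

Definition optval : \bar R := ereal_inf [set obj x | x in feasible].

Definition eq_res x : R := enorm (cA P *m x - cb P).

Definition ineq_res x : R := enorm (\col_i (Num.max 0 (cf P i x) : R)).

Definition eps_optimal (e : R) x : Prop :=
  [/\ cX P x, (`|obj x - optval| <= e%:E)%E & eq_res x + ineq_res x <= e].

Definition standing (L0 : R) (L : 'I_m -> R) : Prop :=
  [/\ closed (cX P) /\ convex_set (cX P),
      convex_function setT (cg P) /\ (forall x, differentiable (cg P) x),
      (forall x, ch P x != -oo%E) /\ econvex (ch P),
      (forall i, convex_function setT (cf P i)
                 /\ forall x, differentiable (cf P i) x)
    & [/\ 0 <= L0 /\ lipschitz_grad cdom L0 (cg P),
          forall i, 0 <= L i /\ lipschitz_grad cdom (L i) (cf P i)
        & bounded_set cdom]].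

Definition kkt x y z : Prop :=
  [/\ exists u v, [/\ subdiff obj x u, normal_cone (cX P) x v &
        u + v + (cA P)^T *m y + \sum_i z i ord0 *: grad (cf P i) x = 0],
      cA P *m x = cb P, cX P x
    & forall i, [/\ 0 <= z i ord0, cf P i x <= 0 & z i ord0 * cf P i x = 0]].

(* mu = 0 encodes the convex case, mu > 0 the strongly convex case. *)
Definition modulus (L0 mu : R) : Prop :=
  mu = 0 \/ (0 < mu <= L0 / 4 /\ strongly_convex mu (cg P)).

Definition psi (beta u v : R) : R :=
  if 0 <= beta * u + v then u * v + beta / 2 * u ^+ 2
  else - (v ^+ 2 / (2 * beta)).

Definition al_terms (beta : R) x y z : R :=
  dot y (cA P *m x - cb P) + beta / 2 * eq_res x ^+ 2
  + \sum_i psi beta (cf P i x) (z i ord0).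

Definition auglag (beta : R) x y z : \bar R :=
  (obj x + (al_terms beta x y z)%:E)%E.

(* auglag - h *)
Definition auglag_smooth (beta : R) y z x : R^o := cg P x + al_terms beta x y z.

Definition inexact_min (beta : R) y z (e : R) : set 'cV[R]_n :=
  [set x | cX P x /\
     (auglag beta x y z
       <= ereal_inf [set auglag beta u y z | u in cX P] + e%:E)%E].

Definition dual_step (rho beta : R) x y z y' z' : Prop :=
  y' = y + rho *: (cA P *m x - cb P) /\
  forall i, z' i ord0 =
    z i ord0 + rho * Num.max (- (z i ord0 / beta)) (cf P i x).

Definition ialm (K : nat) (rho beta epss : nat -> R) (x : nat -> 'cV[R]_n)
    (y : nat -> 'cV[R]_p) (z : nat -> 'cV[R]_m) : Prop :=
  cdom (x 0%N) /\
  forall k, (k < K)%N ->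
    inexact_min (beta k) (y k) (z k) (epss k) (x k.+1) /\
    dual_step (rho k) (beta k) (x k.+1) (y k) (z k) (y k.+1) (z k.+1).

Definition avg_point (K : nat) (rho : nat -> R) (x : nat -> 'cV[R]_n) :
    'cV[R]_n :=
  \sum_(k < K) (rho k / \sum_(t < K) rho t) *: x k.+1.

Definition fbounds (B : 'I_m -> R) : Prop :=
  forall i,
    (forall x, cdom x -> Num.max `|cf P i x| (enorm (grad (cf P i) x)) <= B i)
    /\ forall x u, cdom x -> cdom u ->
         `|cf P i x - cf P i u| <= B i * enorm (x - u).

Definition Lphi (L0 : R) (L B : 'I_m -> R) (beta : R) z : R :=
  L0 + beta * opnorm ((cA P)^T *m cA P)
  + \sum_i (beta * B i * (B i + L i) + L i * `|z i ord0|).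

End ConvexProgram.

Section Settings.
Context {R : realType}.
Implicit Types (rho beta epss : nat -> R).

Definition setting1 (K : nat) (Cb Ce e : R) rho beta epss : Prop :=
  forall k, (k < K)%N ->
    [/\ rho k = beta k, beta k = Cb / (K%:R * e)
      & epss k = e / 2 * (Ce / Cb)].

Definition geometric (K : nat) (Cb sigma e : R) rho beta : Prop :=
  exists2 bg : R, 0 < bg &
    (forall k, (k < K)%N -> rho k = beta k /\ beta k = bg * sigma ^+ k)
    /\ \sum_(k < K) beta k = Cb / e.

Definition setting2 (K : nat) (Cb Ce sigma e : R) rho beta epss : Prop :=
  geometric K Cb sigma e rho beta /\
  forall k, (k < K)%N -> epss k = e / 2 * (Ce / Cb).

(* The tolerance depends on the case: mu = 0 convex, mu > 0 strongly convex. *)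
Definition setting3 (K : nat) (Cb Ce sigma mu e : R) rho beta epss : Prop :=
  geometric K Cb sigma e rho beta /\
  forall k, (k < K)%N ->
    epss k = if mu == 0
      then Ce / (2 * beta k `^ (1 / 3)) / \sum_(t < K) beta t `^ (2 / 3)
      else Ce / (2 * beta k `^ (1 / 2)) / \sum_(t < K) beta t `^ (1 / 2).

End Settings.

Section Nesterov.
Context {R : realType} {n : nat}.
Implicit Types (w wh : nat -> 'cV[R]_n) (acc : set 'cV[R]_n).

(* acc is the set of points that meet the requested accuracy; the method stops
   at the first iterate in acc, so that stops_at acc w t says that exactly t
   iterations are performed. *)
Definition running acc w (j : nat) : Prop :=
  forall i, (i <= j)%N -> ~ acc (w i).

Definition stops_at acc w (t : nat) : Prop :=
  acc (w t) /\ forall i, (i < t)%N -> ~ acc (w i).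

Definition prox_model (phi : 'cV[R]_n -> R^o) (psi : 'cV[R]_n -> \bar R)
    (L : R) (v u : 'cV[R]_n) : \bar R :=
  ((dot (grad phi v) u + L / 2 * enorm (u - v) ^+ 2)%:E + psi u)%E.

(* Only the iterations performed before stopping are constrained. *)
Definition nesterov (phi : 'cV[R]_n -> R^o) (psi : 'cV[R]_n -> \bar R)
    (L mu : R) (w0 : 'cV[R]_n) acc w wh (alpha : nat -> R) : Prop :=
  [/\ w 0%N = w0, wh 0%N = w0,
      alpha 0%N = (if mu == 0 then 1 else Num.sqrt (mu / L))
    & forall j, running acc w j ->
      [/\ forall u, (prox_model phi psi L (wh j) (w j.+1)
                      <= prox_model phi psi L (wh j) u)%E,
          alpha j.+1 = (mu / L - alpha j ^+ 2
            + Num.sqrt ((mu / L - alpha j ^+ 2) ^+ 2 + 4 * alpha j ^+ 2)) / 2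
        & wh j.+1 = w j.+1 +
            (alpha j * (1 - alpha j) / (alpha j ^+ 2 + alpha j.+1))
              *: (w j.+1 - w j)]].

(* The method minimizes phi + psi for phi with L-Lipschitz gradient. The
   extrapolated points wh j may lie outside dom psi, so the Lipschitz bound is
   required on a convex set that contains both: D = setT is a globally
   Lipschitz gradient, and D = dom psi is possible when no extrapolated point
   leaves dom psi. *)
Definition nesterov_applicable (dom : set 'cV[R]_n) (phi : 'cV[R]_n -> R^o)
    (L : R) acc w wh : Prop :=
  exists D : set 'cV[R]_n,
    [/\ convex_set D, dom `<=` D, lipschitz_grad D L phi
      & forall j, running acc w j -> D (wh j)].

End Nesterov.

Definition nesterov_subproblem {R : realType} {n p m : nat}
    (P : cvxprog R n p m) (L0 : R) (L B : 'I_m -> R) (mu beta : R)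
    (y : 'cV[R]_p) (z : 'cV[R]_m) (e : R) (w0 : 'cV[R]_n)
    (w wh : nat -> 'cV[R]_n) (alpha : nat -> R) : Prop :=
  let phi := auglag_smooth P beta y z in
  let Lf := Lphi P L0 L B beta z in
  let acc := inexact_min P beta y z e in
  nesterov_applicable (cdom P) phi Lf acc w wh /\
  nesterov phi (fun u => (ch P u + eindic (cX P) u)%E) Lf mu w0 acc w wh alpha.

(* Main.v *)
(** When [rho_k = beta_k], completing squares turns the augmented terms at
    [x_{k+1}] into the dual increments
    [(|y_{k+1}|^2 - |y_k|^2 + |z_{k+1}|^2 - |z_k|^2) / (2 beta_k)], so inexact
    minimality tested at [xs] telescopes.  With the KKT lower bound
    [f0 x - f0 xs >= - <ys, A x - b> - <zs, f x>] this bounds all dual iterates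
    by a constant depending only on [Ce], [ys] and [zs].  As [y_K] and [z_K]
    dominate the weighted sums of the residuals, Jensen's inequality gives (a);
    the last iteration alone gives (b), since [beta_{K-1}] is comparable to
    [Cb / e].  For (c), in all settings both the smoothness constants and the
    [1 / epss_k] are [O(1 / e)].  The rates of the accelerated method are proved
    against an arbitrary comparison point of the domain (the subproblems need
    not have minimizers), and in terms of the diameter of the domain only. *)

Require Import Defs.
From mathcomp Require Import all_boot all_order all_algebra.
From mathcomp Require Import all_classical all_reals all_analysis.
From mathcomp Require Import ring lra.
Import Order.TTheory GRing.Theory Num.Theory.
Import numFieldNormedType.Exports.
Local Open Scope classical_set_scope.
Local Open Scope ring_scope.

Set Implicit Arguments.
Unset Strict Implicit.
Unset Printing Implicit Defensive.

(** * Euclidean geometry and first-order inequalities *)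

Section EuclideanSpace.
Context {R : realType} {n : nat}.
Implicit Types (u v w : 'cV[R]_n) (a : R).

(** The tolerances are calibrated so that the products [beta k * epss k] sum to exactly [Ce / 2] in
    every setting, although both factors depend on [e]. This makes the dual bound free of [e], and
    with it the multiplier term in the smoothness constant [Lf]. The accelerated method then needs
    about [sqrt (Lf / epss k)] steps in the convex case and [sqrt (Lf / mu) * ln (Lf / epss k)] in
    the strongly convex one; since [K] is fixed, one cap for all subproblems suffices. Two obstacles
    shape the rates. The gap [F (w j) - F u] to an arbitrary [u] may be negative, so the Lyapunov
    recursions must not use its sign. And [h] may be arbitrarily large at the starting point, so
    [F (w 0)] must not enter: the initial bound comes from the first proximal step. *)

Lemma dotE u v : dot u v = \sum_i u i ord0 * v i ord0.
Proof. by rewrite /dot mxE; apply: eq_bigr => i _; rewrite mxE. Qed.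

Lemma dotC u v : dot u v = dot v u.
Proof. by rewrite !dotE; apply: eq_bigr => i _; rewrite mulrC. Qed.

Lemma dotDl u v w : dot (u + v) w = dot u w + dot v w.
Proof. by rewrite /dot linearD mulmxDl mxE. Qed.

Lemma dotZl a u v : dot (a *: u) v = a * dot u v.
Proof. by rewrite /dot linearZ -scalemxAl mxE. Qed.

Lemma dotNl u v : dot (- u) v = - dot u v.
Proof. by rewrite -scaleN1r dotZl mulN1r. Qed.

Lemma dotBl u v w : dot (u - v) w = dot u w - dot v w.
Proof. by rewrite dotDl dotNl. Qed.

Lemma dotDr u v w : dot w (u + v) = dot w u + dot w v.
Proof. by rewrite dotC dotDl !(dotC w). Qed.

Lemma dotZr a u v : dot u (a *: v) = a * dot u v.
Proof. by rewrite dotC dotZl dotC. Qed.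

Lemma dotNr u v : dot u (- v) = - dot u v.
Proof. by rewrite dotC dotNl dotC. Qed.

Lemma dot0l u : dot 0 u = 0.
Proof. by rewrite -(scale0r 0) dotZl mul0r. Qed.

Lemma dot_suml (I : finType) (F : I -> 'cV[R]_n) v :
  dot (\sum_i F i) v = \sum_i dot (F i) v.
Proof. by apply: (big_morph (fun u => dot u v)) => [u w|]; rewrite ?dotDl ?dot0l. Qed.

Lemma dotuu_ge0 u : 0 <= dot u u.
Proof. by rewrite dotE sumr_ge0// => i _; rewrite -expr2 sqr_ge0. Qed.

Lemma enorm_ge0 u : 0 <= enorm u.
Proof. exact: sqrtr_ge0. Qed.

Lemma enorm_sqr u : enorm u ^+ 2 = dot u u.
Proof. by rewrite sqr_sqrtr// dotuu_ge0. Qed.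

Lemma dotuuD u v : dot (u + v) (u + v) = dot u u + 2 * dot u v + dot v v.
Proof. rewrite !(dotDl, dotDr) (dotC v u); ring. Qed.

Lemma dot_le_enorm u v : dot u v <= enorm u * enorm v.
Proof.
have [uv|uv] := leP (dot u v) 0.
  by rewrite (le_trans uv)// mulr_ge0// enorm_ge0.
have quad t : 0 <= dot u u - 2 * t * dot u v + t ^+ 2 * dot v v.
  have := dotuu_ge0 (u + (- t) *: v); rewrite dotuuD !(dotZl, dotZr); lra.
rewrite -(@ler_pXn2r _ 2)// ?nnegrE ?mulr_ge0 ?enorm_ge0 ?(ltW uv)//.
rewrite exprMn !enorm_sqr.
have [vv0|vv0] := eqVneq (dot v v) 0.
  (* With [dot v v = 0] the quadratic is affine in [t]; this [t] makes it equal to [-1]. *)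
  have := quad ((dot u u + 1) / (2 * dot u v)).
  have -> : 2 * ((dot u u + 1) / (2 * dot u v)) * dot u v = dot u u + 1.
    by field; rewrite gt_eqF.
  rewrite vv0; lra.
have vv : 0 < dot v v by rewrite lt_neqAle eq_sym vv0 dotuu_ge0.
have := quad (dot u v / dot v v).
have -> : dot u u - 2 * (dot u v / dot v v) * dot u v +
    (dot u v / dot v v) ^+ 2 * dot v v = dot u u - dot u v ^+ 2 / dot v v.
  by field.
by rewrite subr_ge0 ler_pdivrMr.
Qed.

Lemma enormD u v : enorm (u + v) <= enorm u + enorm v.
Proof.
rewrite -(@ler_pXn2r _ 2)// ?nnegrE ?addr_ge0 ?enorm_ge0//.
rewrite enorm_sqr sqrrD !enorm_sqr dotuuD.
have := dot_le_enorm u v; lra.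
Qed.

Lemma enormZ a u : enorm (a *: u) = `|a| * enorm u.
Proof. by rewrite /enorm dotZl dotZr mulrA -expr2 sqrtrM ?sqr_ge0// sqrtr_sqr. Qed.

Lemma enormN u : enorm (- u) = enorm u.
Proof. by rewrite -scaleN1r enormZ normrN1 mul1r. Qed.

Lemma enormB u v : enorm (u - v) = enorm (v - u).
Proof. by rewrite -enormN opprB. Qed.

Lemma coord_le_enorm u i : `|u i ord0| <= enorm u.
Proof.
rewrite -(@ler_pXn2r _ 2)// ?nnegrE ?enorm_ge0// enorm_sqr dotE real_normK ?num_real//.
rewrite (bigD1 i)//= expr2 lerDl sumr_ge0// => j _.
by rewrite -expr2 sqr_ge0.
Qed.

Lemma enorm_mono u v : (forall i, `|u i ord0| <= `|v i ord0|) -> enorm u <= enorm v.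
Proof.
move=> uv; rewrite -(@ler_pXn2r _ 2)// ?nnegrE ?enorm_ge0// !enorm_sqr !dotE.
apply: ler_sum => i _; rewrite -!expr2 -[_ ^+ 2]real_normK ?num_real//.
by rewrite -[leRHS]real_normK ?num_real// ler_pXn2r ?nnegrE.
Qed.

Lemma enorm_le_norm u : enorm u <= n%:R * `|u|.
Proof.
have le_u i : `|u i ord0| <= `|u|.
  by rewrite [leRHS]mx_normrE; exact: (le_bigmax _ (fun ij => `|u ij.1 ij.2|) (i, ord0)).
rewrite -(@ler_pXn2r _ 2)// ?nnegrE ?enorm_ge0 ?mulr_ge0//.
rewrite enorm_sqr dotE (@le_trans _ _ (\sum_(i < n) `|u| ^+ 2))//.
  apply: ler_sum => i _; rewrite -expr2 -[leLHS]real_normK ?num_real//.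
  by rewrite ler_pXn2r ?nnegrE.
rewrite sumr_const card_ord exprMn -[leLHS]mulr_natl ler_wpM2r ?sqr_ge0//.
by rewrite -natrX ler_nat; case: n => // k; rewrite leq_pmulr.
Qed.

Lemma enorm_bounded (D : set 'cV[R]_n) : bounded_set D ->
  exists2 d : R, 1 <= d & forall x y, D x -> D y -> enorm (x - y) <= d.
Proof.
move=> [M [_ /(_ (M + 1))]]; rewrite ltrDl ltr01 => /(_ isT) bD.
exists (1 + `|n%:R * (2 * (M + 1))|); first by rewrite lerDl.
move=> x y Dx Dy; rewrite (le_trans (enorm_le_norm _))//.
rewrite ler_wpDl//; apply: le_trans (ler_norm _).
rewrite ler_wpM2l// (le_trans (ler_normB _ _))//.
by rewrite mulr_natl mulr2n lerD// bD.
Qed.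

End EuclideanSpace.

Section Convexity.
Context {R : realType} {n : nat}.
Implicit Types (x y v : 'cV[R]_n) (f : 'cV[R]_n -> R^o).

Lemma convex_setP (X : set 'cV[R]_n) : convex_set X ->
  forall x y (t : R), X x -> X y -> 0 <= t <= 1 -> X (t *: x + (1 - t) *: y).
Proof.
move=> cX x y t Xx Xy /andP[t0 t1].
by have /set_mem := cX x y (Itv01 t0 t1) (mem_set Xx) (mem_set Xy).
Qed.

(** Lets the modulus [0] stand for plain convexity, so that one set of inequalities serves both
    cases. *)
Lemma convex_functionP f : convex_function setT f -> strongly_convex 0 f.
Proof.
move=> cf x y t /andP[t0 t1].
have := cf (Itv01 t0 t1) x y (in_setT _) (in_setT _).
by rewrite !mul0r subr0.
Qed.

Lemma strongly_convexW f (mu nu : R) : nu <= mu ->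
  strongly_convex mu f -> strongly_convex nu f.
Proof.
move=> numu cf x y t t01; apply: le_trans (cf x y t t01) _.
have /andP[t0 t1] := t01.
rewrite lerD2l lerN2 ler_wpM2r ?sqr_ge0// ler_wpM2r ?mulr_ge0 ?subr_ge0//.
by rewrite ler_pM2r// invr_gt0.
Qed.

Lemma convex_D (X : set 'cV[R]_n) : convex_set X ->
  forall x v (t : R), X x -> X (x + v) -> 0 <= t <= 1 -> X (x + t *: v).
Proof.
move=> cX x v t Xx Xv t01; have := convex_setP cX Xv Xx t01.
by rewrite scalerDr scalerBl scale1r addrC addrA subrK.
Qed.

Lemma dot_grad f x v : differentiable f x -> dot (grad f x) v = 'd f x v.
Proof.
move=> df; have {2}-> : v = \sum_i v i ord0 *: delta_mx i ord0.
  by rewrite {1}[v]matrix_sum_delta; apply: eq_bigr => i _; rewrite big_ord1.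
rewrite linear_sum dotE; apply: eq_bigr => i _.
by rewrite linearZ mxE mulrC.
Qed.

(** Convexity on the segment bounds the difference quotient at [x] with step [h] by
    [f v - f x - k + k * h], where [k] is the modulus term; then [h] tends to [0] from the right. *)
Lemma first_order (mu : R) f x v : strongly_convex mu f -> differentiable f x ->
  f x + dot (grad f x) (v - x) + mu / 2 * enorm (v - x) ^+ 2 <= f v.
Proof.
move=> cf df; rewrite dot_grad// -deriveE//.
set d := v - x.
have dfx : derivable f x d by exact: diff_derivable.
pose k := mu / 2 * enorm d ^+ 2.
have cq : (h^-1 *: ((f \o shift x) (h *: d) - f x)) @[h --> 0^'+] --> 'D_d f x.
  exact: cvg_dnbhs_at_right.
have cr : (f v - f x - k + k * h : R) @[h --> 0^'+] --> f v - f x - k + k * 0.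
  apply: cvg_at_right_filter; apply: cvgD; first exact: cvg_cst.
  by apply: cvgM; [exact: cvg_cst|exact: cvg_id].
have : 'D_d f x <= f v - f x - k + k * 0.
  apply: (ler_cvg_to cq cr); near=> h.
  have h0 : 0 < h by near: h; exact: nbhs_right_gt.
  have h1 : h <= 1 by near: h; apply: nbhs_right_le.
  have := cf v x h; rewrite (ltW h0) h1 => /(_ isT).
  have -> : h *: v + (1 - h) *: x = h *: d + x.
    by rewrite /d scalerBr scalerBl scale1r addrA -addrA [x - _]addrC addrA.
  move=> le_f; rewrite /= [_ *: _]mulrC ler_pdivrMr//; move: le_f.
  rewrite -/d /k; lra.
rewrite mulr0 -/k; lra.
Unshelve. all: by end_near. Qed.

(** Serves as the passage to the limit [t -> 0] in later arguments, sampled at [t = 1 / (N + 1)]. *)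
Lemma ge0_harmonic (a b : R) :
  (forall N : nat, 0 <= a + b / N.+1%:R) -> 0 <= a.
Proof.
move=> ab; rewrite leNgt; apply/negP => a0.
have := ab (Num.truncn (`|b| / - a)); apply/negP; rewrite -ltNge.
have N0 : 0 < (Num.truncn (`|b| / - a)).+1%:R :> R by [].
rewrite -ltrBrDl sub0r ltr_pdivrMr// (le_lt_trans (ler_norm b))//.
rewrite mulrC -ltr_pdivrMr ?oppr_gt0//.
exact: truncnS_gt.
Qed.

(* Chains the first-order inequality along the points [x + (k / N) d] and lets
   [N] tend to infinity. *)
Lemma descent (D : set 'cV[R]_n) (L : R) f x v : strongly_convex 0 f ->
  (forall u, differentiable f u) -> convex_set D -> lipschitz_grad D L f ->
  D x -> D v ->
  f v <= f x + dot (grad f x) (v - x) + L / 2 * enorm (v - x) ^+ 2.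
Proof.
move=> cf df cD lf Dx; have [d ->] : exists d, v = x + d by exists (v - x); rewrite subrKC.
have -> : x + d - x = d by rewrite addrC addKr.
move=> Dd.
have dk s : 0 <= s <= 1 ->
    dot (grad f (x + s *: d)) d <= dot (grad f x) d + L * s * enorm d ^+ 2.
  move=> s01; have /andP[s0 _] := s01.
  have := lf _ _ (convex_D cD Dx Dd s01) Dx.
  have -> : x + s *: d - x = s *: d by rewrite addrC addKr.
  rewrite enormZ (ger0_norm s0) => lk.
  have := dot_le_enorm (grad f (x + s *: d) - grad f x) d.
  rewrite dotBl => dk; rewrite -lerBlDl (le_trans dk)//.
  by rewrite expr2 mulrA ler_wpM2r ?enorm_ge0// -mulrA.
suff H N : f (x + d) <= f x + dot (grad f x) d
    + L * enorm d ^+ 2 * ((N.+1%:R + 1) / (2 * N.+1%:R)).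
  rewrite -subr_ge0; apply: (@ge0_harmonic _ (L * enorm d ^+ 2 / 2)) => N.
  have := H N; rewrite -subr_ge0; have : N.+1%:R != 0 :> R by [].
  by move: (N.+1%:R : R) => M M0; congr (0 <= _); field.
have N0 : 0 < N.+1%:R :> R by [].
suff H k : (k <= N.+1)%N -> f (x + (k%:R / N.+1%:R) *: d) <= f x +
    k%:R / N.+1%:R * dot (grad f x) d
    + L * enorm d ^+ 2 * (k%:R * (k%:R + 1) / (2 * N.+1%:R ^+ 2)).
  have := H N.+1 (leqnn _); rewrite divff// scale1r mul1r.
  by move: N0; move: (N.+1%:R : R) => M M0; congr (_ <= _ + _); field; rewrite gt_eqF.
elim: k => [|k IHk] kN.
  by rewrite !mul0r scale0r !addr0 mulr0 addr0.
(* The tangent at the new point, evaluated at the previous one, bounds the increment from above;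
   [dk] then controls that gradient by the one at [x]. *)
apply: le_trans (_ : _ <= f (x + (k%:R / N.+1%:R) *: d) +
  (N.+1%:R)^-1 * dot (grad f (x + (k.+1%:R / N.+1%:R) *: d)) d) _.
  have := first_order (x + (k%:R / N.+1%:R) *: d) cf (df (x + (k.+1%:R / N.+1%:R) *: d)).
  have -> : x + (k%:R / N.+1%:R) *: d - (x + (k.+1%:R / N.+1%:R) *: d)
    = - (N.+1%:R)^-1 *: d.
    rewrite opprD addrACA subrr add0r -scalerBl; congr (_ *: _).
    by rewrite -[k.+1%:R]natr1; move: N0; move: (N.+1%:R : R) => M M0; field; rewrite gt_eqF.
  rewrite dotZr !mul0r addr0 mulNr lerBlDr; exact.
have le1 j : (j <= N.+1)%N -> 0 <= (j%:R / N.+1%:R : R) <= 1.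
  by move=> jN; rewrite divr_ge0//= ler_pdivrMr// mul1r ler_nat.
have {}dk := dk _ (le1 _ kN).
have Ni0 : 0 <= (N.+1%:R)^-1 :> R by rewrite invr_ge0.
have {}dk := ler_wpM2l Ni0 dk.
apply: le_trans (lerD (IHk (ltnW kN)) dk) _.
rewrite le_eqVlt; apply/orP; left; apply/eqP.
by rewrite -[k.+1%:R]natr1; move: N0; move: (N.+1%:R : R) => M M0; field; rewrite gt_eqF.
Qed.

End Convexity.

(** * The accelerated proximal gradient method *)

Section ProximalGradient.
Context {R : realType} {n : nat}.
Implicit Types (S D : set 'cV[R]_n) (F : 'cV[R]_n -> R).

(** Convexity of [S] is built in because the extended-valued objective will be replaced by a real
    function that is meaningful on the domain only. *)
Definition convex_on (mu : R) S F : Prop :=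
  forall (x y : 'cV[R]_n) (t : R), S x -> S y -> 0 <= t <= 1 ->
    S (t *: x + (1 - t) *: y) /\
    F (t *: x + (1 - t) *: y) <=
      t * F x + (1 - t) * F y - mu / 2 * (t * (1 - t)) * enorm (x - y) ^+ 2.

(** The only fact about a proximal step that the rates use; [v] is any point of [S], and [wh] may
    lie outside [S]. *)
Definition gradient_step (mu L : R) S F (wh wp : 'cV[R]_n) : Prop :=
  S wp /\ forall v, S v ->
    F wp + L / 2 * enorm (v - wp) ^+ 2 <=
      F v + (L - mu) / 2 * enorm (v - wh) ^+ 2.

(** Sum of three inequalities: optimality of [wp] in the model, strong convexity of [phi] from [wh]
    to [v], and the descent bound from [wh] to [wp]. *)
Lemma prox_gradient_step (mu L : R) S D (phi : 'cV[R]_n -> R^o)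
    (F Psi : 'cV[R]_n -> R) (wh wp : 'cV[R]_n) :
  0 <= mu -> strongly_convex mu phi -> (forall u, differentiable phi u) ->
  convex_set D -> lipschitz_grad D L phi -> S `<=` D -> convex_on 0 S Psi ->
  (forall u, F u = phi u + Psi u) -> D wh -> S wp ->
  (forall u, S u ->
    dot (grad phi wh) wp + L / 2 * enorm (wp - wh) ^+ 2 + Psi wp
    <= dot (grad phi wh) u + L / 2 * enorm (u - wh) ^+ 2 + Psi u) ->
  gradient_step mu L S F wh wp.
Proof.
move=> mu0 cphi dphi cD lphi SD cPsi FE Dwh Swp wpmin; split=> // v Sv.
(* Variational inequality at [wp]: compare with [wp + t (v - wp)], divide by [t] and let [t] tend to
   [0]. This needs only convexity of [Psi]. *)
have opt : 0 <= dot (grad phi wh) (v - wp) + L * dot (wp - wh) (v - wp)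
    + (Psi v - Psi wp).
  apply: (@ge0_harmonic _ _ (L / 2 * enorm (v - wp) ^+ 2)) => N.
  have t0 : 0 < (N.+1%:R)^-1 :> R by rewrite invr_gt0.
  have t1 : (N.+1%:R)^-1 <= 1 :> R by rewrite invf_le1 ?ler1n.
  move: t0 t1; move: (N.+1%:R^-1 : R) => t t0 t1.
  have t01 : 0 <= t <= 1 by rewrite ltW.
  have [Su] := cPsi v wp t Sv Swp t01; rewrite !mul0r subr0.
  move: (wpmin _ Su).
  have -> : t *: v + (1 - t) *: wp = wp + t *: (v - wp).
    by apply/matrixP => i j; rewrite !mxE; ring.
  have -> : wp + t *: (v - wp) - wh = (wp - wh) + t *: (v - wp) by rewrite addrAC.
  rewrite !enorm_sqr [dot (_ + t *: _) _]dotuuD [dot (grad _ _) (_ + _)]dotDr.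
  rewrite !dotZr !dotZl => le_min Psile.
  rewrite -(pmulr_rge0 _ t0); lra.
have := first_order v cphi (dphi wh).
have := descent (strongly_convexW mu0 cphi) dphi cD lphi Dwh (SD _ Swp).
rewrite !FE.
have -> : v - wh = (wp - wh) + (v - wp) by rewrite [RHS]addrC addrA subrK.
rewrite !enorm_sqr [dot (wp - wh + _) _]dotuuD [dot (grad _ _) (_ + (v - wp))]dotDr; lra.
Qed.

End ProximalGradient.

(** * Convex case: the quadratic rate *)

Section FistaRate.
Context {R : realType} {n : nat}.
Variables (S : set 'cV[R]_n) (F : 'cV[R]_n -> R) (w wh : nat -> 'cV[R]_n)
  (alpha : nat -> R).

(* The [0] stands for [mu / L]; the last bound says that [1 / alpha] grows at
   least by [1 / 2] per iteration. *)
Lemma fista_alpha (a b : R) : 0 < a <= 1 ->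
  b = (0 - a ^+ 2 + Num.sqrt ((0 - a ^+ 2) ^+ 2 + 4 * a ^+ 2)) / 2 ->
  [/\ 0 < b <= 1, b ^+ 2 = (1 - b) * a ^+ 2 & a^-1 + 2^-1 <= b^-1].
Proof.
move=> /andP[a0 a1] bE.
have a2 : 0 < a ^+ 2 by rewrite exprn_gt0.
have s0 : 0 <= (0 - a ^+ 2) ^+ 2 + 4 * a ^+ 2.
  by apply: addr_ge0; [exact: sqr_ge0|rewrite mulr_ge0// ltW].
set s := Num.sqrt _ in bE.
have s2 : s ^+ 2 = (0 - a ^+ 2) ^+ 2 + 4 * a ^+ 2 by rewrite sqr_sqrtr.
have bpol : b ^+ 2 = (1 - b) * a ^+ 2.
  have -> : b ^+ 2 = (a ^+ 4 - 2 * a ^+ 2 * s + s ^+ 2) / 4 by rewrite bE; field.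
  by rewrite s2 bE; field.
have b0 : 0 < b.
  rewrite bE divr_gt0// sub0r addrC subr_gt0.
  rewrite -(@ltr_pXn2r _ 2)// ?nnegrE ?sqrtr_ge0 ?(ltW a2)// s2 sub0r sqrrN.
  by rewrite ltrDl mulr_gt0.
have b1 : b < 1.
  have : 0 < (1 - b) * a ^+ 2 by rewrite -bpol exprn_gt0.
  by rewrite pmulr_lgt0// subr_gt0.
split=> //; first by rewrite b0 ltW.
have bi1 : 1 < b^-1 by rewrite invf_gt1.
have ai0 : 0 < a^-1 by rewrite invr_gt0.
(* The recursion reads [b^-2 - b^-1 = a^-2]; complete the square. *)
have eqt : (b^-1 - 2^-1) ^+ 2 = a^-1 ^+ 2 + 4^-1.
  have -> : a^-1 ^+ 2 = (1 - b) / b ^+ 2.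
    by rewrite bpol; field; rewrite !gt_eqF ?subr_gt0.
  by field; rewrite gt_eqF.
rewrite -lerBrDr -(@ler_pXn2r _ 2) ?nnegrE//; [|lra..].
by rewrite eqt lerDl.
Qed.

(** The Lyapunov function in [lyap] never increases. The recursion for [alpha] is an equality, so
    the gap may have either sign. Since [1 / alpha N >= (N + 2) / 2], the gap decays
    quadratically. *)
Lemma fista_rate (L d : R) (N : nat) (u : 'cV[R]_n) :
  0 <= L -> convex_on 0 S F -> S u -> enorm (w 0%N - u) <= d ->
  wh 0%N = w 0%N -> alpha 0%N = 1 ->
  (forall j, (j <= N)%N -> [/\ gradient_step 0 L S F (wh j) (w j.+1),
     alpha j.+1 = (0 - alpha j ^+ 2
       + Num.sqrt ((0 - alpha j ^+ 2) ^+ 2 + 4 * alpha j ^+ 2)) / 2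
   & wh j.+1 = w j.+1 + (alpha j * (1 - alpha j) / (alpha j ^+ 2 + alpha j.+1))
               *: (w j.+1 - w j)]) ->
  F (w N.+1) <= F u + 2 * L * d ^+ 2 / N.+2%:R ^+ 2.
Proof.
move=> L0 cF Su w0d wh0 a0 step.
have aP j : (j <= N)%N -> 0 < alpha j <= 1 /\ j.+2%:R / 2 <= (alpha j)^-1.
  elim: j => [|j IHj] jN; first by rewrite a0 ltr01 lexx invr1 divff.
  have [aj ajn] := IHj (ltnW jN).
  have [_ aE _] := step j (ltnW jN).
  have [-> _ le_a] := fista_alpha aj aE; split=> //.
  by apply: le_trans le_a; rewrite -[j.+3%:R]natr1 mulrDl mul1r lerD2r.
have lyap j : (j <= N)%N ->
    (F (w j.+1) - F u) / alpha j ^+ 2 +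
    L / 2 * enorm (u - (w j + (alpha j)^-1 *: (w j.+1 - w j))) ^+ 2
    <= L / 2 * d ^+ 2.
  elim: j => [|j IHj] jN.
    have [[_ /(_ u Su)]] := step 0%N jN.
    (* As [alpha 0 = 1], the first step compares [w 1] with [u] directly and [F (w 0)] does not
       appear. *)
    rewrite a0 invr1 scale1r expr1n divr1 subrKC wh0 subr0 => H _ _.
    suff : L / 2 * enorm (u - w 0) ^+ 2 <= L / 2 * d ^+ 2 by lra.
    have d0 := le_trans (enorm_ge0 _) w0d.
    by rewrite ler_wpM2l ?divr_ge0// ler_pXn2r ?nnegrE ?enorm_ge0// enormB.
  have [/andP[aj0 aj1] _] := aP j (ltnW jN).
  have [/andP[bj0 bj1] _] := aP j.+1 jN.
  have [[Sw _] aE whE] := step j (ltnW jN).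
  have [_ pol _] := fista_alpha (introT andP (conj aj0 aj1)) aE.
  have [[_ gs] _ _] := step j.+1 jN.
  apply: le_trans (IHj (ltnW jN)).
  have b01 : 0 <= alpha j.+1 <= 1 by rewrite ltW.
  (* The step is tested at a convex combination of [u] and [w j.+1]. The momentum is designed so
     that this point minus [wh j.+1] is a multiple of the vector in the previous potential. *)
  have [Sv Fv] := cF u (w j.+1) (alpha j.+1) Su Sw b01.
  have := gs _ Sv.
  have -> : alpha j.+1 *: u + (1 - alpha j.+1) *: w j.+1 - wh j.+1 =
      alpha j.+1 *: (u - (w j + (alpha j)^-1 *: (w j.+1 - w j))).
    rewrite whE.
    have -> : alpha j * (1 - alpha j) / (alpha j ^+ 2 + alpha j.+1) =
       alpha j.+1 * ((alpha j)^-1 - 1).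
      have b1 : 0 < 1 - alpha j.+1.
        have : 0 < (1 - alpha j.+1) * alpha j ^+ 2 by rewrite -pol exprn_gt0.
        by rewrite pmulr_lgt0// exprn_gt0.
      apply: (@mulIf _ (alpha j ^+ 2 + alpha j.+1)); first by rewrite gt_eqF ?addr_gt0 ?exprn_gt0.
      rewrite divfK ?gt_eqF ?addr_gt0 ?exprn_gt0//.
      have -> : alpha j.+1 * ((alpha j)^-1 - 1) * (alpha j ^+ 2 + alpha j.+1) =
         ((alpha j)^-1 - 1) * (alpha j.+1 * alpha j ^+ 2 + alpha j.+1 ^+ 2) by ring.
      rewrite pol; field; exact: lt0r_neq0.
    by apply/matrixP => i k; rewrite !mxE; ring.
  have -> : alpha j.+1 *: u + (1 - alpha j.+1) *: w j.+1 - w j.+2 =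
      alpha j.+1 *: (u - (w j.+1 + (alpha j.+1)^-1 *: (w j.+2 - w j.+1))).
    by apply/matrixP => i k; rewrite !mxE; field; exact: lt0r_neq0.
  move: (u - (w j + _)) (u - (w j.+1 + _)) => z1 z2.
  rewrite !enormZ (ger0_norm (ltW bj0)) !exprMn subr0.
  move: (enorm _ ^+ 2) (enorm _ ^+ 2) => e1 e2 Fw.
  have b2 : 0 < alpha j.+1 ^+ 2 by rewrite exprn_gt0.
  rewrite -(ler_pM2l b2) !mulrDr.
  have -> : alpha j.+1 ^+ 2 * ((F (w j.+2) - F u) / alpha j.+1 ^+ 2) = F (w j.+2) - F u.
    by field; exact: lt0r_neq0.
  have -> : alpha j.+1 ^+ 2 * ((F (w j.+1) - F u) / alpha j ^+ 2) =
     (1 - alpha j.+1) * (F (w j.+1) - F u).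
    by rewrite pol; field; exact: lt0r_neq0.
  move: Fv Fw; lra.
have := lyap N (leqnn N).
have [/andP[aN0 aN1] leN] := aP N (leqnn N).
move: (enorm _) => e le_lyap.
have le1 : (F (w N.+1) - F u) / alpha N ^+ 2 <= L / 2 * d ^+ 2.
  apply: le_trans le_lyap; rewrite lerDl mulr_ge0 ?divr_ge0 ?sqr_ge0//.
rewrite ler_pdivrMr ?exprn_gt0// in le1.
rewrite -lerBlDl (le_trans le1)//.
have -> : 2 * L * d ^+ 2 / N.+2%:R ^+ 2 = L / 2 * d ^+ 2 * ((N.+2%:R / 2)^-1) ^+ 2.
  by have : N.+2%:R != 0 :> R by []; move: (N.+2%:R : R) => M M0; field.
have M0 : 0 < N.+2%:R / 2 :> R by rewrite divr_gt0.
apply: ler_wpM2l; first by apply: mulr_ge0; [rewrite divr_ge0|exact: sqr_ge0].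
rewrite ler_pXn2r ?nnegrE ?invr_ge0 ?(ltW M0) ?(ltW aN0)//.
by rewrite -[alpha N]invrK lef_pV2 ?posrE ?invr_gt0.
Qed.

End FistaRate.

(** * Strongly convex case: the linear rate *)

Section StrongRate.
Context {R : realType} {n : nat}.
Variables (S : set 'cV[R]_n) (F : 'cV[R]_n -> R) (w wh : nat -> 'cV[R]_n)
  (alpha : nat -> R).

(** The difference of the two sides is [a |q - c|^2]. *)
Lemma enorm_mix (a : R) (q c : 'cV[R]_n) : 0 <= a ->
  enorm (a *: q + c) ^+ 2 <= (1 + a) * (a * enorm q ^+ 2 + enorm c ^+ 2).
Proof.
move=> a0; have := mulr_ge0 a0 (dotuu_ge0 (q - c)).
rewrite !enorm_sqr !dotuuD !(dotZl, dotZr) !(dotNl, dotNr) opprK; lra.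
Qed.

(** Started at [a = sqrt (mu / L)], the sequence [alpha] is constant, and the potential in [lyap]
    contracts by [1 - a <= expR (- a)] per step. The constant [3] collects [1] for the initial gap
    and [2] for the initial distance term. *)
Lemma strong_fista_rate (L mu d : R) (N : nat) (u : 'cV[R]_n) :
  0 < mu < L -> convex_on mu S F -> S u -> S (w 0%N) ->
  (forall x y, S x -> S y -> enorm (x - y) <= d) ->
  wh 0%N = w 0%N -> alpha 0%N = Num.sqrt (mu / L) ->
  (forall j, (j <= N)%N -> [/\ gradient_step mu L S F (wh j) (w j.+1),
     alpha j.+1 = (mu / L - alpha j ^+ 2
       + Num.sqrt ((mu / L - alpha j ^+ 2) ^+ 2 + 4 * alpha j ^+ 2)) / 2
   & wh j.+1 = w j.+1 + (alpha j * (1 - alpha j) / (alpha j ^+ 2 + alpha j.+1))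
               *: (w j.+1 - w j)]) ->
  F (w N.+1) <= F u + 3 * L * d ^+ 2 * expR (- (N%:R * Num.sqrt (mu / L))).
Proof.
move=> /andP[mu0 muL] cF Su S0 bS wh0 a0 step.
have L0 : 0 < L by exact: lt_trans muL.
have d0 : 0 <= d by apply: le_trans (bS _ _ Su Su); rewrite enorm_ge0.
set a := Num.sqrt (mu / L) in a0 *.
have a_gt0 : 0 < a by rewrite sqrtr_gt0 divr_gt0.
have a2 : a ^+ 2 = mu / L by rewrite sqr_sqrtr// divr_ge0// ltW.
have a_lt1 : a < 1.
  rewrite -(@ltr_pXn2r _ 2) ?nnegrE ?(ltW a_gt0)// a2 expr1n ltr_pdivrMr//.
  by rewrite mul1r.
have muE : mu = L * a ^+ 2 by rewrite a2 mulrC divfK// gt_eqF.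
have aE j : (j <= N.+1)%N -> alpha j = a.
  elim: j => // j IHj jN; have [_ -> _] := step j jN.
  rewrite IHj ?(ltnW jN)// -a2 subrr expr0n/= add0r add0r.
  rewrite (_ : 4 * a ^+ 2 = (2 * a) ^+ 2); last by ring.
  by rewrite sqrtr_sqr ger0_norm ?mulr_ge0 ?ltW//; field.
have [V VE] : exists V, forall j, V j = w j + a^-1 *: (w j.+1 - w j) by eexists.
have lyap j : (j <= N)%N ->
    F (w j.+1) - F u + mu / 2 * enorm (u - V j) ^+ 2
    <= (1 - a) ^+ j * (3 * L * d ^+ 2).
  elim: j => [|j IHj] jN.
    (* The first step already bounds the gap by [L d^2], whatever [F (w 0)]. *)
    have [[S1 gs] _ _] := step 0%N jN.
    have H := gs u Su; rewrite wh0 in H; rewrite expr0 mul1r.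
    have le_d : enorm (u - w 0%N) ^+ 2 <= d ^+ 2.
      by rewrite ler_pXn2r ?nnegrE ?enorm_ge0// bS.
    (* [V 0] extrapolates by [1 / a] and may leave the domain, but [mu = L a^2] compensates the
       factor [1 / a^2]. *)
    have le_V : enorm (u - V 0%N) <= 2 * d / a.
      have -> : u - V 0%N = - ((a^-1 - 1) *: (u - w 0%N)) + a^-1 *: (u - w 1%N).
        by rewrite VE; apply/matrixP => i k; rewrite !mxE; ring.
      have ai1 : 1 < a^-1 by rewrite invf_gt1.
      rewrite (le_trans (enormD _ _))// enormN !enormZ ger0_norm ?subr_ge0 ?(ltW ai1)//.
      rewrite ger0_norm ?invr_ge0 ?(ltW a_gt0)//.
      have := ler_wpM2l (ltW (lt_trans ltr01 ai1)) (bS _ _ Su S1).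
      have : (a^-1 - 1) * enorm (u - w 0%N) <= (a^-1 - 1) * d.
        by rewrite ler_wpM2l ?bS// subr_ge0 ltW.
      move: d0; move: (a^-1) ai1 (enorm _) (enorm _) => b b1 e1 e2; nra.
    have le_V2 : mu / 2 * enorm (u - V 0%N) ^+ 2 <= 2 * L * d ^+ 2.
      have -> : 2 * L * d ^+ 2 = mu / 2 * (2 * d / a) ^+ 2.
        by rewrite muE; field; exact: lt0r_neq0.
      rewrite ler_wpM2l ?divr_ge0 ?(ltW mu0)//.
      by rewrite ler_pXn2r ?nnegrE ?enorm_ge0// !mulr_ge0 ?invr_ge0 ?(ltW a_gt0).
    have : (L - mu) / 2 * enorm (u - w 0%N) ^+ 2 <= (L - mu) / 2 * d ^+ 2.
      by rewrite ler_wpM2l// divr_ge0// subr_ge0 ltW.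
    have : 0 <= mu * d ^+ 2 by rewrite mulr_ge0 ?sqr_ge0 ?ltW.
    have : 0 <= L * d ^+ 2 by rewrite mulr_ge0 ?sqr_ge0 ?ltW.
    have : 0 <= L / 2 * enorm (u - w 1%N) ^+ 2.
      by rewrite mulr_ge0 ?divr_ge0 ?sqr_ge0 ?ltW.
    move: H le_V2; lra.
  have [[Sw _] _ whE] := step j (ltnW jN).
  have [[_ gs] _ _] := step j.+1 jN.
  rewrite [leRHS](_ : _ = (1 - a) * ((1 - a) ^+ j * (3 * L * d ^+ 2))); last first.
    by rewrite exprS mulrA.
  have a1_ge0 : 0 <= 1 - a by rewrite subr_ge0 ltW.
  apply: le_trans (ler_wpM2l a1_ge0 (IHj (ltnW jN))).
  have a01 : 0 <= a <= 1 by rewrite !ltW.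
  have [Sv Fv] := cF u (w j.+1) a Su Sw a01.
  have := gs _ Sv.
  have [q qE] : exists q, q = u - w j.+1 by eexists.
  have [c cE] : exists c, c = u - V j by eexists.
  rewrite -qE in Fv.
  have -> : a *: u + (1 - a) *: w j.+1 - wh j.+1 = (a / (1 + a)) *: (a *: q + c).
    rewrite whE (aE j.+1 (leqW jN)) (aE j (leqW (ltnW jN))).
    rewrite cE qE VE; apply/matrixP => i k; rewrite !mxE; field.
    by rewrite !gt_eqF ?addr_gt0 ?exprn_gt0.
  have -> : a *: u + (1 - a) *: w j.+1 - w j.+2 = a *: (u - V j.+1).
    by rewrite VE; apply/matrixP => i k; rewrite !mxE; field; exact: lt0r_neq0.
  rewrite !enormZ (ger0_norm (ltW a_gt0)) ger0_norm ?divr_ge0 ?addr_ge0 ?(ltW a_gt0)//.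
  rewrite !exprMn.
  have -> : L / 2 * (a ^+ 2 * enorm (u - V j.+1) ^+ 2) =
    mu / 2 * enorm (u - V j.+1) ^+ 2 by rewrite muE; ring.
  (* [L - mu = L (1 - a) (1 + a)]. One factor [1 + a] is absorbed by [enorm_mix], and the resulting
     [q] term cancels against the strong convexity term in [Fv]. *)
  have -> : (L - mu) / 2 * (a ^+ 2 * (1 + a)^-1 ^+ 2 * enorm (a *: q + c) ^+ 2) =
     mu / 2 * (1 - a) * (enorm (a *: q + c) ^+ 2 / (1 + a)).
    by rewrite muE; field; rewrite gt_eqF ?addr_gt0.
  have : enorm (a *: q + c) ^+ 2 / (1 + a) <= a * enorm q ^+ 2 + enorm c ^+ 2.
    rewrite ler_pdivrMr ?addr_gt0//.
    by rewrite mulrC; exact/enorm_mix/ltW.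
  have mua : 0 <= mu / 2 * (1 - a) by rewrite mulr_ge0 ?divr_ge0 ?subr_ge0 ?ltW.
  move=> /(ler_wpM2l mua); move: Fv.
  rewrite -cE.
  move: (enorm (u - V j.+1) ^+ 2) (enorm (a *: q + c) ^+ 2 / (1 + a)) => e1 e2.
  move: (enorm q ^+ 2) (enorm c ^+ 2) => e3 e4; lra.
have mV : 0 <= mu / 2 * enorm (u - V N) ^+ 2 by rewrite mulr_ge0 ?divr_ge0 ?sqr_ge0 ?ltW.
rewrite -lerBlDl; apply: le_trans (_ : _ <= F (w N.+1) - F u + _) _.
  by rewrite lerDl; exact: mV.
apply: le_trans (lyap N (leqnn N)) _.
rewrite mulrC ler_wpM2l ?(mulr_ge0, sqr_ge0, ltW L0)//.
rewrite -mulrN mulrC expRM_natr lerXn2r ?nnegrE ?subr_ge0 ?(ltW a_lt1) ?expR_ge0//.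
exact: expR_ge1Dx.
Qed.

End StrongRate.

(** * The augmented Lagrangian *)

Section Penalty.
Context {R : realType}.
Implicit Types (beta u v s t : R).

(** Closed form without case split; the positive part in it is the updated multiplier, which links
    [psi] to the dual step. *)
Lemma psiE beta u v : 0 < beta ->
  psi beta u v = (Num.max 0 (beta * u + v) ^+ 2 - v ^+ 2) / (2 * beta).
Proof.
move=> b0; rewrite /psi; case: ifPn => [p|].
  by rewrite (max_idPr p); field; exact: lt0r_neq0.
rewrite -ltNge => /ltW p; rewrite (max_idPl p).
by field; exact: lt0r_neq0.
Qed.

Lemma psi_le beta u v s : 0 < beta -> u <= s -> psi beta u v <= psi beta s v.
Proof.
move=> b0 us; rewrite !psiE// ler_pM2r ?invr_gt0 ?mulr_gt0// lerD2r.
have m0 w : 0 <= Num.max 0 w :> R by rewrite le_max lexx.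
rewrite lerXn2r ?nnegrE ?m0//.
by rewrite ge_max !le_max lexx lerD2r ler_pM2l// us orbT.
Qed.

Lemma psi_convex beta u s v t : 0 < beta -> 0 <= t <= 1 ->
  psi beta (t * u + (1 - t) * s) v <= t * psi beta u v + (1 - t) * psi beta s v.
Proof.
move=> b0 /andP[t0 t1]; rewrite !psiE// !mulrA -mulrDl.
rewrite ler_pM2r ?invr_gt0 ?mulr_gt0//.
set M := Num.max 0 (beta * u + v); set M' := Num.max 0 (beta * s + v).
have M0 : 0 <= M by rewrite le_max lexx.
have M'0 : 0 <= M' by rewrite le_max lexx.
have leM : beta * u + v <= M by rewrite le_max lexx orbT.
have leM' : beta * s + v <= M' by rewrite le_max lexx orbT.
have t1' : 0 <= 1 - t by rewrite subr_ge0.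
have le1 : Num.max 0 (beta * (t * u + (1 - t) * s) + v) <= t * M + (1 - t) * M'.
  rewrite ge_max addr_ge0 ?mulr_ge0//=.
  have := ler_wpM2l t0 leM; have := ler_wpM2l t1' leM'; lra.
have le2 : Num.max 0 (beta * (t * u + (1 - t) * s) + v) ^+ 2
    <= (t * M + (1 - t) * M') ^+ 2.
  rewrite lerXn2r ?nnegrE//; last by rewrite addr_ge0 ?mulr_ge0.
  by rewrite le_max lexx.
have : 0 <= t * (1 - t) * (M - M') ^+ 2 by rewrite mulr_ge0 ?sqr_ge0 ?mulr_ge0.
move: le2; lra.
Qed.

Lemma psi_differentiable beta u v : 0 < beta ->
  differentiable (fun s : R => psi beta s v : R^o) u.
Proof.
move=> b0; apply/derivable1_diffP.
pose c := Num.max 0 (beta * u + v).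
apply/cvg_ex; exists (c : R^o).
apply/cvgrPdist_le => e e0; near=> h.
have h0 : h != 0 by near: h; exact: nbhs_dnbhs_neq.
have he : `|h| <= 2 * e / beta.
  near: h; apply: dnbhs0_le; rewrite divr_gt0 ?mulr_gt0//.
rewrite /= [_ *: 1]mulr1 !psiE//.
have -> : beta * (h + u) + v = (beta * u + v) + beta * h by ring.
rewrite /c; set s := beta * u + v; set M := Num.max 0 s.
set M' := Num.max 0 (s + beta * h).
(* The squared positive part has a quadratic remainder even across its kink, with derivative twice
   the positive part. *)
have key : `|M' ^+ 2 - M ^+ 2 - 2 * M * (beta * h)| <= (beta * h) ^+ 2.
  rewrite ler_norml /M' /M !maxEle.
  by case: ifPn; case: ifPn => ? ?; apply/andP; split; nra.
have alg (r r' : R) : r - h^-1 * ((r' ^+ 2 - v ^+ 2) / (2 * beta)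
      - (r ^+ 2 - v ^+ 2) / (2 * beta))
   = - (r' ^+ 2 - r ^+ 2 - 2 * r * (beta * h)) / (2 * beta * h).
  by field; rewrite h0 lt0r_neq0.
rewrite [X in `|X|](alg M M').
have d0 : 2 * beta * h != 0 by rewrite !mulf_neq0// gt_eqF.
rewrite normrM normrN normfV ler_pdivrMr ?normr_gt0//.
apply: le_trans key _; rewrite !normrM (gtr0_norm b0) ger0_norm//.
rewrite exprMn -[h ^+ 2]real_normK ?num_real//.
rewrite ler_pdivlMr// in he.
have n0 : 0 <= `|h| by [].
have := ler_wpM2l (mulr_ge0 (ltW b0) n0) he; move: (`|h|) => a; lra.
Unshelve. all: by end_near. Qed.

End Penalty.

Section AugLag.
Context {R : realType} {n p m : nat}.
Variable P : cvxprog R n p m.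
Hypothesis cvxg : convex_function setT (cg P).
Hypothesis dg : forall x, differentiable (cg P) x.
Hypothesis cvxf : forall i, convex_function setT (cf P i).
Hypothesis df : forall i x, differentiable (cf P i) x.

Lemma differentiable_fsum k (V : normedModType R) (f : 'I_k -> V -> R^o) x :
  (forall i, differentiable (f i) x) ->
  differentiable (fun u => \sum_i f i u : R^o) x.
Proof.
move=> dfi; rewrite (_ : (fun u => _) = \sum_i f i); first exact: differentiable_sum.
by apply/funext => u; rewrite fct_sumE.
Qed.

Lemma residual_differentiable (i : 'I_p) (x : 'cV[R]_n) :
  differentiable (fun u : 'cV[R]_n => (cA P *m u - cb P) i ord0 : R^o) x.
Proof.
rewrite (_ : (fun u => _) = (fun u : 'cV[R]_n => \sum_j cA P i j * u j ord0 : R^o)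
   - cst (cb P i ord0 : R^o)); last by apply/funext => u; rewrite !mxE.
apply: differentiableB; last exact: differentiable_cst.
apply: differentiable_fsum => j.
apply: (@differentiableM _ _ (cst (cA P i j)) (fun u : 'cV[R]_n => u j ord0)).
  exact: differentiable_cst.
exact: differentiable_coord.
Qed.

Lemma auglag_smooth_differentiable (beta : R) y z x : 0 < beta ->
  differentiable (auglag_smooth P beta y z) x.
Proof.
move=> b0.
(* The Euclidean norm is not differentiable at [0]; its square is handled as a sum of squares. *)
have eqr : eq_res P =1 (fun u => Num.sqrt (\sum_i (cA P *m u - cb P) i ord0 ^+ 2)).
  by move=> u; rewrite /eq_res /enorm dotE; under eq_bigr do rewrite -expr2.
have d1 : differentiable (fun u : 'cV[R]_n =>
    \sum_i y i ord0 * (cA P *m u - cb P) i ord0 : R^o) x.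
  apply: differentiable_fsum => i.
  apply: (@differentiableM _ _ (cst (y i ord0))); first exact: differentiable_cst.
  exact: residual_differentiable.
have d2 : differentiable (fun u : 'cV[R]_n =>
    \sum_i (cA P *m u - cb P) i ord0 ^+ 2 : R^o) x.
  apply: differentiable_fsum => i.
  exact: differentiableM (residual_differentiable i x) (residual_differentiable i x).
have d3 : differentiable (fun u : 'cV[R]_n =>
    \sum_i psi beta (cf P i u) (z i ord0) : R^o) x.
  apply: differentiable_fsum => i.
  apply: (@differentiable_comp _ _ _ _ (cf P i) (fun s : R^o => psi beta s (z i ord0))) => //.
  exact: psi_differentiable.
have := differentiableD (dg x) (differentiableD (differentiableD d1
  (differentiableM (differentiable_cst (beta / 2 : R^o) x) d2)) d3).
move=> /(eq_ind _ (fun F => differentiable F x)); apply; apply/funext => u.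
rewrite /auglag_smooth /al_terms /= dotE eqr sqr_sqrtr//.
by apply: sumr_ge0 => i _; rewrite sqr_ge0.
Qed.

Lemma al_terms_convex (beta : R) y z (u v : 'cV[R]_n) (t : R) :
  0 < beta -> 0 <= t <= 1 ->
  al_terms P beta (t *: u + (1 - t) *: v) y z <=
    t * al_terms P beta u y z + (1 - t) * al_terms P beta v y z.
Proof.
move=> b0 t01; have /andP[t0 t1] := t01; rewrite /al_terms !mulrDr.
have ABE : cA P *m (t *: u + (1 - t) *: v) - cb P =
    t *: (cA P *m u - cb P) + (1 - t) *: (cA P *m v - cb P).
  rewrite mulmxDr -!scalemxAr; move: (cA P *m u) (cA P *m v) => q r.
  by apply/matrixP => i j; rewrite !mxE; ring.
apply: le_trans (_ : _ <=
    (t * dot y (cA P *m u - cb P) + (1 - t) * dot y (cA P *m v - cb P))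
  + (t * (beta / 2 * eq_res P u ^+ 2) + (1 - t) * (beta / 2 * eq_res P v ^+ 2))
  + (t * (\sum_i psi beta (cf P i u) (z i ord0))
     + (1 - t) * (\sum_i psi beta (cf P i v) (z i ord0)))) _; last first.
  by rewrite le_eqVlt; apply/orP; left; apply/eqP; ring.
apply: lerD; [apply: lerD|].
- by rewrite ABE dotDr !dotZr.
- rewrite /eq_res ABE !enorm_sqr.
  move: (cA P *m u - cb P) (cA P *m v - cb P) => q r.
  rewrite dotuuD !(dotZl, dotZr).
  have : 0 <= beta * (t * (1 - t)) * dot (q - r) (q - r).
    by rewrite !mulr_ge0 ?dotuu_ge0 ?(ltW b0) ?subr_ge0.
  rewrite dotuuD !(dotNl, dotNr); lra.
(* [psi] is convex and nondecreasing in its first argument, hence convex after composition with a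
   convex [f_i]. *)
- rewrite !mulr_sumr -big_split/=; apply: ler_sum => i _.
  apply: le_trans (psi_convex _ _ _ b0 t01); apply: psi_le => //.
  by have := convex_functionP (cvxf i) u v t01; rewrite !mul0r subr0.
Qed.

Lemma auglag_smooth_convex (mu beta : R) y z : 0 < beta ->
  strongly_convex mu (cg P) -> strongly_convex mu (auglag_smooth P beta y z).
Proof.
move=> b0 cg u v t t01; have := al_terms_convex y z u v b0 t01.
have := cg u v t t01; rewrite /auglag_smooth; lra.
Qed.

End AugLag.

(** Weights stay unnormalised, so the induction step is one convex combination of the previous mean
    and the new point. *)
Lemma jensen_on (R : realType) n (S : set 'cV[R]_n) (F : 'cV[R]_n -> R)
    (l : nat -> R) (x : nat -> 'cV[R]_n) (N : nat) :
  convex_on 0 S F -> (forall k, (k < N.+1)%N -> 0 < l k /\ S (x k)) ->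
  S ((\sum_(k < N.+1) l k)^-1 *: \sum_(k < N.+1) l k *: x k) /\
  F ((\sum_(k < N.+1) l k)^-1 *: \sum_(k < N.+1) l k *: x k) <=
    (\sum_(k < N.+1) l k)^-1 * \sum_(k < N.+1) l k * F (x k).
Proof.
move=> cF; elim: N => [|N IHN] lx.
  have [l0 S0] := lx 0%N isT.
  by rewrite !big_ord1 scalerA mulrA mulVf ?gt_eqF// scale1r mul1r.
have {IHN} [SN FN] := IHN (fun k kN => lx k (leqW kN)).
have [lN xN] := lx N.+1 (leqnn _).
rewrite !(big_ord_recr N.+1)/=.
have s0 : 0 < \sum_(k < N.+1) l k.
  rewrite big_ord_recl ltr_wpDr//; last by have [] := lx 0%N isT.
  by apply: sumr_ge0 => k _; have [/ltW] := lx (lift ord0 k) (ltnW (ltn_ord _)).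
move: s0 SN FN; move: (\sum_(k < N.+1) l k) (\sum_(k < N.+1) l k *: x k)
  (\sum_(k < N.+1) l k * F (x k)) => s p q s0 Sp Fp.
have sl : 0 < s + l N.+1 by rewrite addr_gt0.
have t01 : 0 <= s / (s + l N.+1) <= 1.
  by rewrite divr_ge0 ?(ltW s0, ltW sl)//= ler_pdivrMr// mul1r lerDl ltW.
have := cF _ _ _ Sp xN t01.
have -> : (s / (s + l N.+1)) *: (s^-1 *: p) + (1 - s / (s + l N.+1)) *: x N.+1
   = (s + l N.+1)^-1 *: (p + l N.+1 *: x N.+1).
  by apply/matrixP => i k; rewrite !mxE; field; rewrite !gt_eqF.
move=> [Sv Fv]; split=> //; apply: le_trans Fv _; rewrite !mul0r subr0.
have -> : (s + l N.+1)^-1 * (q + l N.+1 * F (x N.+1)) =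
   s / (s + l N.+1) * (s^-1 * q) + (1 - s / (s + l N.+1)) * F (x N.+1).
  by field; rewrite !gt_eqF.
by rewrite lerD2r ler_wpM2l// divr_ge0 ?ltW.
Qed.

(** * The objective on its domain and the KKT conditions *)

Section Saddle.
Context {R : realType} {n p m : nat}.
Variable P : cvxprog R n p m.
Variables (L0 : R) (L : 'I_m -> R).
Hypothesis std : standing P L0 L.

(** [fine] sends [+oo] to [0], so this is the objective on [cdom P] only. *)
Definition robj (x : 'cV[R]_n) : R := cg P x + fine (ch P x).

Lemma cdom_chE x : cdom P x -> ch P x = (fine (ch P x))%:E.
Proof.
case: std => _ _ [chN _] _ _ [hx _]; rewrite fineK//.
by rewrite fin_numE chN/= lt_eqF.
Qed.

Lemma objE x : cdom P x -> obj P x = (robj x)%:E.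
Proof. by move=> dx; rewrite /obj cdom_chE// EFinD. Qed.

Lemma auglagE beta y z x : cdom P x ->
  auglag P beta x y z = (robj x + al_terms P beta x y z)%:E.
Proof. by move=> dx; rewrite /auglag objE// EFinD. Qed.

Lemma objNdom x : cX P x -> ~ cdom P x -> obj P x = +oo%E.
Proof.
move=> Xx ndx; rewrite /obj; suff -> : ch P x = +oo%E by rewrite addey.
by apply/eqP; rewrite eq_le leey/= leNgt; apply/negP => hx; exact: ndx.
Qed.

Lemma dom_of_obj x : cX P x -> (obj P x < +oo)%E -> cdom P x.
Proof. by move=> Xx fx; apply: contrapT => /(objNdom Xx) xy; rewrite xy ltxx in fx. Qed.

Lemma h_convex : convex_on 0 (cdom P) (fun x => fine (ch P x)).
Proof.
case: std => -[_ cXX] _ [_ cch] _ _ x y t dx dy t01.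
have dxy : cdom P (t *: x + (1 - t) *: y).
  split; last exact: (convex_setP cXX dx.2 dy.2 t01).
  apply: le_lt_trans (cch x y t t01) _.
  by rewrite (cdom_chE dx) (cdom_chE dy) -!EFinM -EFinD ltry.
split=> //; rewrite !mul0r subr0 -lee_fin EFinD !EFinM -!cdom_chE//.
exact: cch.
Qed.

Lemma convex_onD mu (S : set 'cV[R]_n) (phi : 'cV[R]_n -> R^o) psi :
  strongly_convex mu phi -> convex_on 0 S psi ->
  convex_on mu S (fun x => phi x + psi x).
Proof.
move=> cphi cpsi x y t Sx Sy t01; have [Sxy] := cpsi x y t Sx Sy t01.
have := cphi x y t t01; split=> //; lra.
Qed.

Lemma robj_convex : convex_on 0 (cdom P) robj.
Proof.
case: std => _ [cgg _] _ _ _.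
exact: convex_onD (convex_functionP cgg) h_convex.
Qed.

(** The point [x1] keeps the infimum below [+oo]; this forces an approximate minimizer into the
    domain. *)
Lemma inexact_minE beta y z e x x1 : cdom P x1 ->
  inexact_min P beta y z e x <-> cdom P x /\ forall u, cdom P u ->
    robj x + al_terms P beta x y z <= robj u + al_terms P beta u y z + e.
Proof.
move=> dx1; split=> [[Xx le_x]|[dx le_x]].
  have le_u u : cX P u -> (auglag P beta x y z <= auglag P beta u y z + e%:E)%E.
    move=> Xu; apply: le_trans le_x _; rewrite leeD2r//.
    by apply: ereal_inf_lbound; exists u.
  have dx : cdom P x.
    apply: dom_of_obj => //; rewrite ltNge leye_eq; apply/negP => /eqP fx.
    have := le_u x1 dx1.2; rewrite (auglagE _ _ _ dx1) /auglag fx addye//.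
  split=> // u du; have := le_u u du.2.
  by rewrite !auglagE// -EFinD lee_fin.
split; first exact: dx.2.
rewrite -leeBlDr//; apply: le_ereal_inf_tmp => _ [u Xu <-].
rewrite leeBlDr//; have [du|ndu] := pselect (cdom P u).
  by rewrite !auglagE// -EFinD lee_fin le_x.
by rewrite [auglag P beta u y z]/auglag (objNdom Xu ndu) addye// leey.
Qed.

Variables (xs : 'cV[R]_n) (ys : 'cV[R]_p) (zs : 'cV[R]_m).
Hypothesis hkkt : kkt P xs ys zs.

Lemma kkt_dom : cdom P xs.
Proof.
case: hkkt => -[u [v [[fin _] _ _]]] _ Xxs _.
by apply: dom_of_obj => //; move: fin; rewrite fin_numElt => /andP[].
Qed.

Lemma dot_trmulmx (A : 'M[R]_(p, n)) y (d : 'cV[R]_n) :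
  dot (A^T *m y) d = dot y (A *m d).
Proof. by rewrite /dot trmx_mul trmxK -mulmxA. Qed.

(** Pair the stationarity identity with [x - xs]: the subgradient, normal cone and first-order
    inequalities bound its terms. *)
Lemma kkt_lower x : cdom P x ->
  robj xs <= robj x + dot ys (cA P *m x - cb P) + \sum_i zs i ord0 * cf P i x.
Proof.
move=> dx; have dxs := kkt_dom.
case: hkkt => -[u [v [[_ /(_ x) subu] /(_ x dx.2) norv sum0]]] Ab _ zf.
move: subu; rewrite (objE dx) (objE dxs) -EFinD lee_fin => subu.
have := congr1 (fun w => dot w (x - xs)) sum0.
rewrite dot0l !dotDl dot_trmulmx dot_suml mulmxBr Ab => sum0'.
have : \sum_i dot (zs i ord0 *: grad (cf P i) xs) (x - xs) <=
   \sum_i zs i ord0 * cf P i x.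
  apply: ler_sum => i _; have [z0 _ zf0] := zf i; rewrite dotZl.
  case: std => _ _ _ /(_ i) [cfi dfi] _.
  have := ler_wpM2l z0 (first_order x (convex_functionP cfi) (dfi xs)).
  rewrite !mul0r addr0; lra.
lra.
Qed.

Lemma optvalE : optval P = (robj xs)%:E.
Proof.
have dxs := kkt_dom; apply/eqP; rewrite eq_le; apply/andP; split.
  apply: ereal_inf_lbound; exists xs; last exact: objE.
  by case: hkkt => _ Ab Xxs zf; split=> // i; case: (zf i).
apply: le_ereal_inf_tmp => _ [x [Xx Ab fx] <-].
have [dx|ndx] := pselect (cdom P x); last by rewrite objNdom// leey.
rewrite objE// lee_fin (le_trans (kkt_lower dx))//.
rewrite Ab subrr dotC dot0l addr0 gerDl.
apply: sumr_le0 => i _; case: hkkt => _ _ _ /(_ i) [z0 _ _].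
by rewrite mulr_ge0_le0.
Qed.

(** Only one-sided bounds are required: the reverse objective bound follows from [kkt_lower] and
    Cauchy-Schwarz at the cost [V * (enorm ys + enorm zs)]. *)
Lemma eps_optimal_bound x (U V c : R) : cdom P x ->
  robj x - robj xs <= U -> eq_res P x + ineq_res P x <= V ->
  U + V * (1 + enorm ys + enorm zs) <= c -> 0 <= U -> eps_optimal P c x.
Proof.
move=> dx leU leV lec U0.
have eq0 : 0 <= eq_res P x by exact: enorm_ge0.
have in0 : 0 <= ineq_res P x by exact: enorm_ge0.
have V0 : 0 <= V by apply: le_trans leV; rewrite addr_ge0.
have ys0 := enorm_ge0 ys; have zs0 := enorm_ge0 zs.
have Vys : 0 <= V * enorm ys by rewrite mulr_ge0.
have Vzs : 0 <= V * enorm zs by rewrite mulr_ge0.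
split; [exact: dx.2| |]; last by apply: le_trans leV _; lra.
rewrite optvalE objE// -EFinB /= lee_fin ler_norml.
apply/andP; split; last by lra.
have := kkt_lower dx.
have l1 : dot ys (cA P *m x - cb P) <= V * enorm ys.
  rewrite (le_trans (dot_le_enorm _ _))// mulrC ler_wpM2r//.
  by apply: le_trans leV; rewrite lerDl.
have l2 : \sum_i zs i ord0 * cf P i x <= V * enorm zs.
  apply: le_trans (_ : _ <= dot zs (\col_i (Num.max 0 (cf P i x) : R))) _.
    rewrite dotE; apply: ler_sum => i _; rewrite mxE.
    case: hkkt => _ _ _ /(_ i) [z0 _ _].
    by rewrite ler_wpM2l// le_max lexx orbT.
  rewrite (le_trans (dot_le_enorm _ _))// mulrC ler_wpM2r//.
  by apply: le_trans leV; rewrite lerDr.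
lra.
Qed.

End Saddle.

(** * Dual iterates *)

Section Ialm.
Context {R : realType} {n p m : nat}.
Variable P : cvxprog R n p m.
Variables (L0 : R) (L : 'I_m -> R).
Hypothesis std : standing P L0 L.
Variables (xs : 'cV[R]_n) (ys : 'cV[R]_p) (zs : 'cV[R]_m).
Hypothesis hkkt : kkt P xs ys zs.

Lemma dual_step_max beta x y z y' z' i : 0 < beta ->
  dual_step P beta beta x y z y' z' ->
  z' i ord0 = Num.max 0 (beta * cf P i x + z i ord0).
Proof.
move=> b0 [_ ->]; rewrite maxr_pMr ?ltW// addrC addr_maxl.
by rewrite mulrN mulrC divfK ?gt_eqF// addNr.
Qed.

Lemma al_terms_dual_step beta x y z y' z' : 0 < beta ->
  dual_step P beta beta x y z y' z' ->
  2 * beta * al_terms P beta x y z =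
    enorm y' ^+ 2 - enorm y ^+ 2 + (enorm z' ^+ 2 - enorm z ^+ 2).
Proof.
move=> b0 ds; rewrite /al_terms mulrDr; congr (_ + _).
  rewrite ds.1 /eq_res !enorm_sqr dotuuD !(dotZl, dotZr).
  by field.
rewrite !enorm_sqr !dotE -sumrB mulr_sumr; apply: eq_bigr => i _.
rewrite (dual_step_max i b0 ds) psiE// -!expr2.
by field; exact: lt0r_neq0.
Qed.

(** The equality terms vanish at [xs], and [psi] is nondecreasing with value [0] at [u = 0] when the
    multiplier is nonnegative. *)
Lemma al_terms_feasible_le0 beta y (z : 'cV[R]_m) : 0 < beta -> (forall i, 0 <= z i ord0) ->
  al_terms P beta xs y z <= 0.
Proof.
move=> b0 z0; case: hkkt => _ Ab _ zf.
rewrite /al_terms /eq_res Ab subrr !(dotC y) dot0l enorm_sqr dot0l mulr0 !add0r.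
apply: sumr_le0 => i _; have [_ fi _] := zf i.
apply: le_trans (psi_le (z i ord0) b0 fi) _.
by rewrite psiE// mulr0 add0r (max_idPr (z0 i)) subrr mul0r.
Qed.

Lemma ialm_step beta e x y (z : 'cV[R]_m) y' (z' : 'cV[R]_m) :
  0 < beta -> (forall i, 0 <= z i ord0) ->
  inexact_min P beta y z e x -> dual_step P beta beta x y z y' z' ->
  [/\ cdom P x, forall i, 0 <= z' i ord0,
      forall i, beta * cf P i x + z i ord0 <= z' i ord0
    & beta * (robj P x - robj P xs) + (enorm y' ^+ 2 + enorm z' ^+ 2) / 2
        - (enorm y ^+ 2 + enorm z ^+ 2) / 2 <= beta * e].
Proof.
move=> b0 z0 ix ds; have dxs := kkt_dom hkkt.
have [dx lex] := (inexact_minE std beta y z e x dxs).1 ix.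
split=> // [i|i|]; [by rewrite (dual_step_max i b0 ds) le_max lexx| |].
  by rewrite (dual_step_max i b0 ds) le_max lexx orbT.
have := lex _ dxs; have := al_terms_feasible_le0 y b0 z0.
have := al_terms_dual_step b0 ds.
move: (al_terms _ _ xs _ _) (al_terms _ _ x _ _) => t1 t2 E t1_le0 le_r.
have : beta * (robj P x + t2) <= beta * (robj P xs + e).
  by rewrite ler_pM2l//; lra.
lra.
Qed.

Variables (beta epss : nat -> R) (x : nat -> 'cV[R]_n) (y : nat -> 'cV[R]_p)
  (z : nat -> 'cV[R]_m).
Hypotheses (y0 : y 0%N = 0) (z0 : z 0%N = 0).

(** A prefix of a run, so that the dual bounds are available while later subproblems are still
    unsolved. *)
Definition ialm_steps N := forall k, (k < N)%N ->
  [/\ 0 < beta k, inexact_min P (beta k) (y k) (z k) (epss k) (x k.+1)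
    & dual_step P (beta k) (beta k) (x k.+1) (y k) (z k) (y k.+1) (z k.+1)].

Lemma ialm_sum N : ialm_steps N ->
  [/\ forall i, 0 <= z N i ord0,
      forall i, \sum_(k < N) beta k * cf P i (x k.+1) <= z N i ord0,
      y N = \sum_(k < N) beta k *: (cA P *m x k.+1 - cb P)
    & \sum_(k < N) beta k * (robj P (x k.+1) - robj P xs)
        + (enorm (y N) ^+ 2 + enorm (z N) ^+ 2) / 2
        <= \sum_(k < N) beta k * epss k].
Proof.
elim: N => [_|N IHN steps].
  rewrite !big_ord0 y0 z0 !enorm_sqr !dot0l addr0 mul0r addr0.
  by split=> // i; rewrite ?big_ord0 mxE.
have [zN fN yN sN] := IHN (fun k kN => steps k (leqW kN)).
have [bN iN dN] := steps N (leqnn _).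
have [_ z'0 fz' stepN] := ialm_step bN zN iN dN.
split=> // [i||]; rewrite !big_ord_recr/=.
- by have := fN i; have := fz' i; lra.
- by rewrite -yN; case: dN.
- move: sN stepN; lra.
Qed.

Lemma ialm_dom N : ialm_steps N -> forall k, (k < N)%N -> cdom P (x k.+1).
Proof.
move=> steps k kN; have [_ /inexact_minE ix _] := steps k kN.
by have [] := (ix _ _ std xs (kkt_dom hkkt)).
Qed.

(** Bounds every [t >= 0] with [t^2 <= Ce + 2 (|ys| + |zs|) t]; the summand [1] spares a square
    root. *)
Definition dual_bound (Ce : R) : R := 1 + Ce + 2 * (enorm ys + enorm zs).

Lemma ialm_dual_bound N Ce : ialm_steps N -> 0 <= Ce ->
  \sum_(k < N) beta k * epss k <= Ce / 2 ->
  enorm (y N) <= dual_bound Ce /\ enorm (z N) <= dual_bound Ce.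
Proof.
move=> steps Ce0 leCe; have [zN fN yN sN] := ialm_sum steps.
have lower : - (enorm ys * enorm (y N) + enorm zs * enorm (z N)) <=
    \sum_(k < N) beta k * (robj P (x k.+1) - robj P xs).
  apply: le_trans (_ : _ <= - (dot ys (y N) + dot zs (z N))) _.
    by rewrite lerN2 lerD// dot_le_enorm.
  apply: le_trans (_ : _ <= - (dot ys (y N) +
     \sum_i zs i ord0 * \sum_(k < N) beta k * cf P i (x k.+1))) _.
    rewrite lerN2 lerD2l dotE; apply: ler_sum => i _; rewrite ler_wpM2l//.
    by case: hkkt => _ _ _ /(_ i) [].
  rewrite yN dotC dot_suml.
  under [X in - (_ + X)]eq_bigr do rewrite mulr_sumr.
  rewrite exchange_big/= -big_split/= -sumrN; apply: ler_sum => k _.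
  have [bk _ _] := steps k (ltn_ord k).
  have := ler_wpM2l (ltW bk) (kkt_lower std hkkt (ialm_dom steps (ltn_ord k))).
  have -> : \sum_i zs i ord0 * (beta k * cf P i (x k.+1)) =
      beta k * (\sum_i zs i ord0 * cf P i (x k.+1)).
    by rewrite mulr_sumr; apply: eq_bigr => i _; rewrite mulrCA.
  rewrite [dot ys _]dotC dotZl; lra.
have := enorm_ge0 (y N); have := enorm_ge0 (z N).
have := enorm_ge0 ys; have := enorm_ge0 zs.
move: lower sN leCe; rewrite /dual_bound.
move: (\sum_(k < N) _) (\sum_(k < N) _) => s1 s2.
move: (enorm ys) (enorm zs) (enorm (y N)) (enorm (z N)) => a b c d l1 l2 l3 b0 a0 d0 c0.
have {l1 l2 l3} H : c ^+ 2 + d ^+ 2 <= Ce + 2 * (a * c + b * d) by lra.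
(* The larger of the two norms satisfies the one-variable inequality behind [dual_bound]. *)
have [cd|/ltW dc] := leP c d; split; nra.
Qed.

End Ialm.

(** * Parameter settings *)

Section SettingFacts.
Context {R : realType}.
Implicit Types (rho beta epss : nat -> R).

(** The common content of the three settings used for the averaged point and the counts. The factor
    [K] comes from the power-type tolerances, whose denominator is a sum of [K] terms. *)
Definition well_set (K : nat) (Cb Ce e : R) rho beta epss : Prop :=
  [/\ forall k, (k < K)%N -> [/\ rho k = beta k, 0 < beta k, beta k <= Cb / e,
        0 < epss k & (epss k)^-1 <= 2 * K%:R * Cb / (Ce * e)],
      \sum_(k < K) beta k = Cb / e
    & \sum_(k < K) beta k * epss k = Ce / 2].

Lemma le_sum_ord K (f : nat -> R) k : (forall j, (j < K)%N -> 0 <= f j) ->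
  (k < K)%N -> f k <= \sum_(j < K) f j.
Proof.
move=> f0 kK; rewrite (bigD1 (Ordinal kK))//= lerDl.
by apply: sumr_ge0 => j _; exact: f0.
Qed.

Lemma geometric_facts K (Cb sigma e : R) rho beta : 0 < Cb -> 0 < e -> 1 < sigma ->
  Defs.geometric K Cb sigma e rho beta ->
  [/\ forall k, (k < K)%N -> [/\ rho k = beta k, 0 < beta k & beta k <= Cb / e],
      \sum_(k < K) beta k = Cb / e
    & forall k, K = k.+1 -> (beta k)^-1 <= sigma / (sigma - 1) / (Cb / e)].
Proof.
move=> Cb0 e0 s1 [bg bg0 [bE bS]].
have s0 : 0 < sigma by exact: lt_trans s1.
have b0 k : (k < K)%N -> 0 < beta k.
  by move=> kK; have [_ ->] := bE k kK; rewrite mulr_gt0// exprn_gt0.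
split=> // [k kK|k KE].
  split; [by have [] := bE k kK|exact: b0|].
  by rewrite -bS; apply: le_sum_ord => // j jK; exact/ltW/b0.
have bk : 0 < beta k by apply: b0; rewrite KE.
have S0 : 0 < Cb / e by rewrite divr_gt0.
(* Geometric sum: the total penalty is at most [sigma / (sigma - 1)] times the last one. *)
have key N : (sigma - 1) * \sum_(j < N) bg * sigma ^+ j <= bg * sigma ^+ N.
  elim: N => [|N IHN]; first by rewrite big_ord0 mulr0 expr0 mulr1 ltW.
  rewrite big_ord_recr/= exprS; move: IHN.
  move: (\sum_(j < N) _) (sigma ^+ N) => s t; lra.
have : (sigma - 1) * (Cb / e) <= sigma * beta k.
  rewrite -bS KE; have [_ ->] := bE k (eq_leq (esym KE)).
  rewrite mulrCA -exprS; apply: le_trans (key k.+1).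
  rewrite ler_wpM2l ?subr_ge0 ?(ltW s1)//; apply: ler_sum => j _.
  by have [_ ->] := bE j (leq_trans (ltn_ord j) (eq_leq (esym KE))).
have s10 : 0 < sigma - 1 by rewrite subr_gt0.
move=> H; rewrite -mulrA -invfM ler_pdivlMr ?(mulr_gt0 s10 S0)//.
by rewrite mulrC ler_pdivrMr.
Qed.

Lemma const_tolerance K (Cb Ce e : R) rho beta epss : (0 < K)%N ->
  0 < Cb -> 0 < Ce -> 0 < e ->
  (forall k, (k < K)%N -> [/\ rho k = beta k, 0 < beta k & beta k <= Cb / e]) ->
  \sum_(k < K) beta k = Cb / e ->
  (forall k, (k < K)%N -> epss k = e / 2 * (Ce / Cb)) ->
  well_set K Cb Ce e rho beta epss.
Proof.
move=> K0 Cb0 Ce0 e0 bP bS eE; split=> // [k kK|].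
  have [-> ? ?] := bP k kK; split=> //.
    by rewrite eE// mulr_gt0// divr_gt0.
  rewrite eE// (_ : (e / 2 * (Ce / Cb))^-1 = 2 * Cb / (Ce * e)); last first.
    by field; rewrite !gt_eqF.
  rewrite ler_pM2r ?invr_gt0 ?mulr_gt0// ler_pM2r// ler_peMr// ler1n//.
rewrite (eq_bigr (fun k : 'I_K => beta k * (e / 2 * (Ce / Cb)))) => [|k _]; last by rewrite eE.
by rewrite -mulr_suml bS; field; rewrite !gt_eqF.
Qed.

Lemma power_tolerance (a b : R) K (Cb Ce e : R) rho beta epss : (0 < K)%N ->
  0 < Cb -> 0 < Ce -> 0 < e -> 0 <= a -> 0 <= b -> a + b = 1 ->
  (forall k, (k < K)%N -> [/\ rho k = beta k, 0 < beta k & beta k <= Cb / e]) ->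
  \sum_(k < K) beta k = Cb / e ->
  (forall k, (k < K)%N ->
     epss k = Ce / (2 * beta k `^ a) / \sum_(t < K) beta t `^ b) ->
  well_set K Cb Ce e rho beta epss.
Proof.
move=> K0 Cb0 Ce0 e0 a0 b0 ab bP bS eE.
have beta0 k : (k < K)%N -> 0 < beta k by move=> /bP [].
have p0 (c : R) k : (k < K)%N -> 0 < beta k `^ c by move=> /beta0; exact: powR_gt0.
have S0 : 0 < Cb / e by rewrite divr_gt0.
have s0 : 0 < \sum_(t < K) beta t `^ b.
  apply: lt_le_trans (le_sum_ord (f := fun t => beta t `^ b) _ K0); first exact: p0.
  by move=> j _; exact: powR_ge0.
have splitE (s : R) : 0 < s -> s = s `^ a * s `^ b.
  move=> s1; rewrite -powRD ?ab ?powRr1 ?ltW//.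
  by rewrite oner_eq0.
split=> // [k kK|].
  have [-> bk bkS] := bP k kK; split=> //.
    by rewrite eE// !divr_gt0// mulr_gt0// p0.
  have -> : (epss k)^-1 = 2 / Ce * (beta k `^ a * \sum_(t < K) beta t `^ b).
    by rewrite eE//; field; rewrite !gt_eqF// p0.
  have -> : 2 * K%:R * Cb / (Ce * e) = 2 / Ce * (K%:R * (Cb / e)) :> R.
    by field; rewrite !gt_eqF.
  rewrite ler_pM2l ?divr_gt0//.
  rewrite mulr_sumr -[K in leRHS]card_ord mulr_natl -sumr_const.
  apply: ler_sum => t _; rewrite [leRHS]splitE//.
  have [_ bt btS] := bP t (ltn_ord t).
  by rewrite ler_pM ?powR_ge0// ge0_ler_powR// ?nnegrE ltW.
rewrite (eq_bigr (fun k : 'I_K => Ce / 2 / (\sum_(t < K) beta t `^ b) * beta k `^ b)).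
  by rewrite -mulr_sumr divfK// gt_eqF.
move=> k _; rewrite eE// {1}[beta k]splitE ?beta0//.
by field; rewrite !gt_eqF// p0.
Qed.

Lemma setting_well_set K (Cb Ce sigma mu e : R) rho beta epss : (0 < K)%N ->
  0 < Cb -> 0 < Ce -> 1 < sigma -> 0 < e ->
  setting1 K Cb Ce e rho beta epss \/
    setting2 K Cb Ce sigma e rho beta epss \/
    setting3 K Cb Ce sigma mu e rho beta epss ->
  well_set K Cb Ce e rho beta epss.
Proof.
move=> K0 Cb0 Ce0 s1 e0.
have KR : 0 < K%:R :> R by rewrite ltr0n.
move=> [set1|[[geo eE]|[geo eE]]].
- apply: const_tolerance => // [k kK||k kK]; last by have [] := set1 k kK.
    have [-> bE _] := set1 k kK; split=> //; first by rewrite bE divr_gt0// mulr_gt0.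
    rewrite bE invfM mulrA mulrAC ler_piMr ?divr_ge0 ?(ltW Cb0) ?(ltW e0)//.
    by rewrite invf_le1// ler1n.
  rewrite (eq_bigr (fun=> Cb / (K%:R * e))) => [|k _]; last by have [] := set1 k (ltn_ord k).
  by rewrite sumr_const card_ord -mulr_natl; field; rewrite !gt_eqF.
- have [bP bS _] := geometric_facts Cb0 e0 s1 geo.
  exact: const_tolerance.
- have [bP bS _] := geometric_facts Cb0 e0 s1 geo.
  have [mu0|mu0] := eqVneq mu 0.
    apply: (@power_tolerance (1 / 3) (2 / 3)) => //; try lra.
    by move=> k kK; rewrite eE// mu0 eqxx.
  apply: (@power_tolerance (1 / 2) (1 / 2)) => //; try lra.
  by move=> k kK; rewrite eE// (negbTE mu0).
Qed.

End SettingFacts.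

Lemma le_sum_prefix (R : numDomainType) (f : nat -> R) M N :
  (M <= N)%N -> (forall j, (j < N)%N -> 0 <= f j) ->
  \sum_(j < M) f j <= \sum_(j < N) f j.
Proof.
move=> MN f0; rewrite -!(big_mkord xpredT f) (big_cat_nat _ MN)//= lerDl.
by rewrite big_nat sumr_ge0// => j /andP[_ jN]; exact: f0.
Qed.

Section Residuals.
Context {R : realType} {n p m : nat}.
Variable P : cvxprog R n p m.

Lemma ineq_res_le x (z : 'cV[R]_m) (s : R) : 0 < s ->
  (forall i, 0 <= z i ord0) -> (forall i, s * cf P i x <= z i ord0) ->
  ineq_res P x <= enorm z / s.
Proof.
move=> s0 z0 fz; have si : 0 <= s^-1 by rewrite invr_ge0 ltW.
rewrite mulrC -[s^-1]ger0_norm// -enormZ.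
apply: enorm_mono => i; rewrite !mxE !ger0_norm ?mulr_ge0 ?le_max ?lexx//.
rewrite ge_max mulr_ge0//= mulrC ler_pdivlMr// mulrC; exact: fz.
Qed.

End Residuals.

(** * Approximate optimality *)

Section Solutions.
Context {R : realType} {n p m : nat}.
Variable P : cvxprog R n p m.
Variables (L0 : R) (L : 'I_m -> R).
Hypothesis std : standing P L0 L.
Variables (xs : 'cV[R]_n) (ys : 'cV[R]_p) (zs : 'cV[R]_m).
Hypothesis hkkt : kkt P xs ys zs.
Variables (K : nat) (Cb Ce e : R) (rho beta epss : nat -> R).
Variables (x : nat -> 'cV[R]_n) (y : nat -> 'cV[R]_p) (z : nat -> 'cV[R]_m).
Hypotheses (Cb0 : 0 < Cb) (Ce0 : 0 < Ce) (e0 : 0 < e).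
Hypothesis ws : well_set K Cb Ce e rho beta epss.
Hypotheses (y0 : y 0%N = 0) (z0 : z 0%N = 0).

Let M := dual_bound ys zs Ce.

Lemma dual_bound_ge0 : 0 <= M.
Proof.
by rewrite /M /dual_bound; have := Ce0; have := enorm_ge0 ys; have := enorm_ge0 zs; lra.
Qed.

Lemma sum_tolerance_le N : (N <= K)%N -> \sum_(k < N) beta k * epss k <= Ce / 2.
Proof.
case: ws => wk _ <- NK.
apply: (le_sum_prefix (f := fun k => beta k * epss k)) => // j /wk [_ b0 _ ep0 _].
by rewrite mulr_ge0 ?ltW.
Qed.

Lemma steps_dual_bound N : (N <= K)%N -> ialm_steps P beta epss x y z N ->
  enorm (y N) <= M /\ enorm (z N) <= M.
Proof.
move=> NK steps.
apply: (ialm_dual_bound std hkkt y0 z0 steps (ltW Ce0)); exact: sum_tolerance_le.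
Qed.

Hypothesis run : ialm P K rho beta epss x y z.

Lemma ialm_stepsP : ialm_steps P beta epss x y z K.
Proof.
case: run => _ steps k kK; have [ix ds] := steps k kK.
by case: ws => /(_ k kK) [rE b0 _ _ _] _ _; rewrite rE in ds.
Qed.

Lemma average_eps_optimal : (0 < K)%N ->
  eps_optimal P ((Ce / (2 * Cb) + 2 * M / Cb * (1 + enorm ys + enorm zs)) * e)
    (avg_point K rho x).
Proof.
case: ws => wk bS _; case: K wk bS ialm_stepsP steps_dual_bound sum_tolerance_le
   => // K' wk bS steps dualb tolb _.
have [yM zM] := dualb _ (leqnn _) steps.
have tolK := tolb _ (leqnn _).
have [zK0 fz yE sumE] := ialm_sum std hkkt y0 z0 steps.
have S0 : 0 < Cb / e by rewrite divr_gt0.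
have lx k : (k < K'.+1)%N -> 0 < beta k /\ cdom P (x k.+1).
  move=> kK; split; last exact: (ialm_dom std hkkt steps kK).
  by have [] := wk k kK.
have avgE : avg_point K'.+1 rho x =
    (Cb / e)^-1 *: \sum_(k < K'.+1) beta k *: x k.+1.
  have rS : \sum_(t < K'.+1) rho t = Cb / e.
    by rewrite -bS; apply: eq_bigr => t _; have [] := wk t (ltn_ord t).
  rewrite /avg_point rS scaler_sumr; apply: eq_bigr => k _.
  have [-> _ _ _ _] := wk k (ltn_ord k).
  by rewrite scalerA mulrC.
have [dxb objb] := jensen_on (robj_convex std) lx.
rewrite bS -avgE in dxb objb.
(* [U] is the summed tolerance over the total weight; [V] uses one [M] for [y K] and one for
   [z K]. *)
apply: (eps_optimal_bound std hkkt (U := Ce / 2 / (Cb / e)) (V := (M + M) / (Cb / e))) => //.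
- rewrite lerBlDl (le_trans objb)// mulrC ler_pdivrMr// mulrDl divfK ?gt_eqF//.
  rewrite -bS mulr_sumr -lerBlDl -sumrB.
  apply: le_trans tolK; apply: le_trans sumE.
  have -> : \sum_(i < K'.+1) (beta i * robj P (x i.+1) - robj P xs * beta i) =
     \sum_(k < K'.+1) beta k * (robj P (x k.+1) - robj P xs).
    by apply: eq_bigr => k _; ring.
  by rewrite lerDl divr_ge0// addr_ge0 ?sqr_ge0.
- rewrite mulrDl lerD//.
    have -> : eq_res P (avg_point K'.+1 rho x) = enorm (y K'.+1) / (Cb / e).
      rewrite /eq_res; have -> : cA P *m avg_point K'.+1 rho x - cb P =
          (Cb / e)^-1 *: y K'.+1.
        rewrite yE; under eq_bigr do rewrite scalerBr.
        rewrite sumrB -scaler_suml bS scalerBr scalerA mulVf ?gt_eqF// scale1r.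
        rewrite avgE -scalemxAr mulmx_sumr; congr (_ *: _ - _).
        by apply: eq_bigr => k _; rewrite -scalemxAr.
      by rewrite enormZ ger0_norm ?invr_ge0 ?(ltW S0)// mulrC.
    by rewrite ler_pM2r ?invr_gt0.
  apply: le_trans (_ : _ <= enorm (z K'.+1) / (Cb / e)) _; last first.
    by rewrite ler_pM2r ?invr_gt0.
  apply: ineq_res_le => // i; apply: le_trans (fz i).
  case: std => _ _ _ /(_ i) [cfi _] _.
  have cfS : convex_on 0 setT (cf P i).
    by move=> u v t _ _ t01; split=> //; exact: convex_functionP.
  have [_] := jensen_on cfS (fun k kK => conj (lx k kK).1 (I : setT (x k.+1))).
  by rewrite bS -avgE mulrC ler_pdivlMr// mulrC.
- rewrite le_eqVlt; apply/orP; left; apply/eqP; field.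
  by rewrite !gt_eqF.
- by apply: divr_ge0; [rewrite divr_ge0// ltW|exact: ltW].
Qed.

(** The energy inequality of the last step alone gives a gap of [(Ce / 2 + M^2) / beta k]. The
    residuals cost [3 M / beta k]: two [M] for the increment of [y], one for the new [z]. *)
Lemma last_eps_optimal (c : R) k : K = k.+1 -> (beta k)^-1 <= c * e -> 0 <= c ->
  eps_optimal P (c * (Ce + M ^+ 2 + 3 * M * (1 + enorm ys + enorm zs)) * e) (x K).
Proof.
move=> KE bc c0; rewrite KE.
have M0 := dual_bound_ge0.
have stepsK := ialm_stepsP.
have kK : (k < K)%N by rewrite KE.
have steps : ialm_steps P beta epss x y z k.
  by move=> j jk; apply: stepsK; exact: ltn_trans kK.
have [yM zM] := steps_dual_bound (ltnW kK) steps.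
have [yM' zM'] := steps_dual_bound (leqnn K) stepsK.
rewrite KE in yM' zM'.
have [zk0 _ _ _] := ialm_sum std hkkt y0 z0 steps.
have [bk ix ds] := stepsK k kK.
have [dx zk1 fz stepk] := ialm_step std hkkt bk zk0 ix ds.
have ys0 := enorm_ge0 ys; have zs0 := enorm_ge0 zs.
have ce : 0 <= c * e by rewrite mulr_ge0// ltW.
have bi0 : 0 <= (beta k)^-1 by rewrite invr_ge0 ltW.
apply: (eps_optimal_bound std hkkt (U := (Ce / 2 + M ^+ 2) * (c * e))
   (V := 3 * M * (c * e))) => //.
- apply: le_trans (_ : _ <= (Ce / 2 + M ^+ 2) * (beta k)^-1) _; last first.
    by rewrite ler_wpM2l// addr_ge0 ?sqr_ge0// divr_ge0// ltW.
  rewrite ler_pdivlMr// mulrC.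
  have le_t : beta k * epss k <= Ce / 2.
    apply: le_trans (sum_tolerance_le (leqnn K)).
    apply: (le_sum_ord (f := fun k => beta k * epss k)) => // j jK.
    by case: ws => /(_ j jK) [_ ? _ ? _] _ _; rewrite mulr_ge0 ?ltW.
  have := enorm_ge0 (y k); have := enorm_ge0 (z k).
  have : enorm (y k) ^+ 2 <= M ^+ 2 by rewrite lerXn2r ?nnegrE ?enorm_ge0.
  have : enorm (z k) ^+ 2 <= M ^+ 2 by rewrite lerXn2r ?nnegrE ?enorm_ge0.
  have := sqr_ge0 (enorm (y k.+1)); have := sqr_ge0 (enorm (z k.+1)).
  move: stepk le_t.
  move: (enorm (y k) ^+ 2) (enorm (z k) ^+ 2) => a1 a2.
  move: (enorm (y k.+1) ^+ 2) (enorm (z k.+1) ^+ 2) => a3 a4; lra.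
- apply: le_trans (_ : _ <= 3 * M * (beta k)^-1) _; last first.
    by rewrite ler_wpM2l// mulr_ge0.
  have -> : 3 * M / beta k = (M + M) / beta k + M / beta k by ring.
  rewrite lerD//.
    rewrite /eq_res; have -> : cA P *m x k.+1 - cb P = (beta k)^-1 *: (y k.+1 - y k).
      by rewrite ds.1 [y k + _]addrC addrK scalerA mulVf ?gt_eqF// scale1r.
    rewrite enormZ (ger0_norm bi0) mulrC ler_wpM2r//.
    by rewrite (le_trans (enormD _ _))// enormN lerD.
  apply: le_trans (_ : _ <= enorm (z k.+1) / beta k) _; last by rewrite ler_wpM2r.
  apply: ineq_res_le => // i; apply: le_trans (fz i).
  by rewrite lerDl.
- rewrite -subr_ge0.
  have : 0 <= Ce / 2 * (c * e) by rewrite mulr_ge0// divr_ge0// ltW.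
  lra.
- by rewrite mulr_ge0// addr_ge0 ?sqr_ge0// divr_ge0// ltW.
Qed.

End Solutions.

(** * Iteration counts *)

Lemma opnorm_ge0 (R : realType) a b (A : 'M[R]_(a, b)) : 0 <= opnorm A.
Proof.
rewrite /opnorm; set E := [set _ | _ in _].
have E0 : E 0.
  exists 0; last by rewrite mulmx0 /enorm dot0l sqrtr0.
  by rewrite /= /enorm dot0l sqrtr0.
(* By convention [sup] is [0] on a set without upper bound, which settles the other case. *)
have [ubE|nubE] := pselect (has_ubound E); first exact: ub_le_sup.
by rewrite sup_out// => -[].
Qed.

Lemma stops_at_bound (R : realType) n (acc : set 'cV[R]_n) (w : nat -> 'cV[R]_n)
    (N t : nat) : ~ running acc w N -> stops_at acc w t -> (t <= N)%N.
Proof.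
move=> nrun [_ nacc]; rewrite leqNgt; apply/negP => Nt; apply: nrun => i iN.
by apply: nacc; exact: leq_ltn_trans Nt.
Qed.

Lemma stops_at_exists (R : realType) n (acc : set 'cV[R]_n) (w : nat -> 'cV[R]_n)
    (N : nat) : ~ running acc w N -> exists t, stops_at acc w t.
Proof.
move=> nrun; have ex : exists i, `[< acc (w i) >].
  apply: contrapT => nex; apply: nrun => i _ ai; apply: nex.
  by exists i; apply/asboolP.
have [t /asboolP at_ min] := ex_minnP ex.
exists t; split=> // i it /asboolP /min; by rewrite leqNgt it.
Qed.

Section Subproblem.
Context {R : realType} {n p m : nat}.
Variable P : cvxprog R n p m.
Variables (L0 : R) (L : 'I_m -> R).
Hypothesis std : standing P L0 L.
Variables (B : 'I_m -> R) (mu beta e : R) (y : 'cV[R]_p) (z : 'cV[R]_m).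
Variables (w0 : 'cV[R]_n) (w wh : nat -> 'cV[R]_n) (alpha : nat -> R).
Hypotheses (hmu : modulus P L0 mu) (beta0 : 0 < beta) (dw0 : cdom P w0).
Hypothesis sub : nesterov_subproblem P L0 L B mu beta y z e w0 w wh alpha.

Let Lf := Lphi P L0 L B beta z.
Let acc := inexact_min P beta y z e.
Let F (u : 'cV[R]_n) : R := auglag_smooth P beta y z u + fine (ch P u).

Lemma modulus_convex : 0 <= mu /\ strongly_convex mu (cg P).
Proof.
case: hmu => [->|[/andP[mu0 _] cg]]; last by split; [exact: ltW|].
by split=> //; case: std => _ [/convex_functionP].
Qed.

Lemma subproblem_convex : convex_on mu (cdom P) F.
Proof.
have [_ cg] := modulus_convex.
apply: convex_onD (h_convex std); apply: auglag_smooth_convex => //.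
by case: std => _ _ _ cf _ i; case: (cf i).
Qed.

Lemma acc_of_bound x : cdom P x ->
  (forall u, cdom P u -> F x <= F u + e) -> acc x.
Proof.
move=> dx le_x; apply/(inexact_minE std _ _ _ _ _ dx); split=> // u du.
by have := le_x u du; rewrite /F /auglag_smooth /robj; lra.
Qed.

Lemma psi_dom u : cdom P u ->
  (ch P u + eindic (cX P) u)%E = (fine (ch P u))%:E.
Proof.
by move=> du; rewrite /eindic (mem_set du.2) adde0 (cdom_chE std).
Qed.

Lemma dom_of_psi u : (ch P u + eindic (cX P) u < +oo)%E -> cdom P u.
Proof.
case: std => _ _ [chN _] _ _; rewrite /eindic.
case: ifPn => [/set_mem Xu|_]; first by rewrite adde0.
by rewrite addeC addye.
Qed.

Lemma subproblem_steps N : running acc w N -> forall j, (j <= N)%N ->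
  [/\ gradient_step mu Lf (cdom P) F (wh j) (w j.+1),
     alpha j.+1 = (mu / Lf - alpha j ^+ 2
       + Num.sqrt ((mu / Lf - alpha j ^+ 2) ^+ 2 + 4 * alpha j ^+ 2)) / 2
   & wh j.+1 = w j.+1 + (alpha j * (1 - alpha j) / (alpha j ^+ 2 + alpha j.+1))
               *: (w j.+1 - w j)].
Proof.
move=> run j jN; have [[D [cD domD lipD whD]] [_ _ _ step]] := sub.
have runj : running acc w j by move=> i ij; apply: run; exact: leq_trans jN.
have [prox aE whE] := step j runj; split=> //.
have [mu0 cg] := modulus_convex.
(* The model is finite at [w0], hence at its minimizer, which therefore lies in the domain. *)
have dwj : cdom P (w j.+1).
  apply: dom_of_psi; have := prox w0; rewrite /prox_model (psi_dom dw0) -EFinD.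
  move: (dot _ (w j.+1) + _) => a /le_lt_trans/(_ (ltry _)).
  by case: (ch P (w j.+1) + eindic (cX P) (w j.+1))%E => [r| |]; rewrite ?ltry ?ltNyr.
apply: (@prox_gradient_step _ _ mu Lf (cdom P) D (auglag_smooth P beta y z) F
   (fun u => fine (ch P u))) => //.
- by apply: auglag_smooth_convex => //; case: std => _ _ _ cf _ i; case: (cf i).
- move=> u; case: std => _ [_ dg] _ cf _; apply: auglag_smooth_differentiable => //.
  by move=> i; case: (cf i).
- exact: (h_convex std).
- exact: whD.
- move=> u du; have := prox u; rewrite /prox_model !psi_dom//.
Qed.

(** The iterates are specified only while the method runs, so the rate is assumed under [running]
    and then contradicts it. *)
Lemma not_running_of_rate N (r : R) :
  (running acc w N.+1 -> forall u, cdom P u -> F (w N.+1) <= F u + r) ->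
  r <= e -> ~ running acc w N.+1.
Proof.
move=> rate re run; apply: (run N.+1 (leqnn _)); apply: acc_of_bound.
  have runN : running acc w N by move=> i iN; apply: run; exact: leqW.
  by have [[]] := subproblem_steps runN (leqnn N).
by move=> u du; apply: le_trans (rate run u du) _; rewrite lerD2l.
Qed.

Variable d : R.
Hypothesis diam : forall u v, cdom P u -> cdom P v -> enorm (u - v) <= d.

Lemma convex_subproblem_stop N : mu = 0 -> 0 <= Lf ->
  2 * Lf * d ^+ 2 / N.+2%:R ^+ 2 <= e -> ~ running acc w N.+1.
Proof.
move=> mu0 Lf0; apply: not_running_of_rate => run u du.
have runN : running acc w N by move=> i iN; apply: run; exact: leqW.
have [_ [w0E wh0E a0E _]] := sub.
apply: (@fista_rate _ _ (cdom P) F w wh alpha Lf d N u) => //.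
- by rewrite -mu0; exact: subproblem_convex.
- by rewrite w0E; exact: diam.
- by rewrite w0E.
- by rewrite a0E mu0 eqxx.
- move=> j jN; have := subproblem_steps runN jN.
  by rewrite mu0 mul0r.
Qed.

Lemma strong_subproblem_stop N : 0 < mu < Lf ->
  3 * Lf * d ^+ 2 * expR (- (N%:R * Num.sqrt (mu / Lf))) <= e ->
  ~ running acc w N.+1.
Proof.
move=> muL; apply: not_running_of_rate => run u du.
have runN : running acc w N by move=> i iN; apply: run; exact: leqW.
have [_ [w0E wh0E a0E _]] := sub.
apply: (@strong_fista_rate _ _ (cdom P) F w wh alpha Lf mu d N u) => //.
- exact: subproblem_convex.
- by rewrite w0E.
- by rewrite w0E.
- by rewrite a0E; case/andP: muL => /gt_eqF ->.
- by move=> j jN; exact: subproblem_steps runN _ jN.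
Qed.

End Subproblem.

(** * From rates to explicit iteration numbers *)

Section Counts.
Context {R : realType}.
Implicit Types (e mu : R).

Lemma truncn_bounds (a : R) : 0 <= a ->
  (Num.truncn a)%:R <= a /\ a <= (Num.truncn a).+1%:R.
Proof. by move=> a0; split; [rewrite truncn_le|exact/ltW/truncnS_gt]. Qed.

(** About [sqrt c / e] steps are needed, and [1 + c] dominates [sqrt c]. *)
Lemma convex_count (C1 C2 d e ek Lf : R) : 0 <= C1 -> 0 <= C2 -> 0 < e <= 1 ->
  0 < ek -> ek^-1 <= C2 / e -> 0 <= Lf -> Lf <= C1 / e ->
  let c := 2 * C1 * C2 * d ^+ 2 in let N := Num.truncn ((1 + c) / e) in
  2 * Lf * d ^+ 2 / N.+2%:R ^+ 2 <= ek /\ N.+1%:R <= (2 + c) / e.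
Proof.
move=> C10 C20 /andP[e0 e1] ek0 ekC Lf0 LfC c N.
have c0 : 0 <= c by rewrite /c mulr_ge0 ?sqr_ge0// !mulr_ge0.
have a0 : 0 <= (1 + c) / e by rewrite divr_ge0 ?addr_ge0// ltW.
have [N1 N2] := truncn_bounds a0; rewrite -/N in N1 N2.
have ei1 : 1 <= e^-1 by rewrite invf_ge1.
split; last first.
  by rewrite -natr1 (_ : (2 + c) / e = (1 + c) / e + e^-1) ?lerD//; field; rewrite gt_eqF.
rewrite ler_pdivrMr ?exprn_gt0//.
have sq : (c / e ^+ 2) <= N.+2%:R ^+ 2.
  apply: le_trans (_ : _ <= ((1 + c) / e) ^+ 2) _; last first.
    rewrite lerXn2r ?nnegrE// (le_trans N2)// ler_nat//.
  rewrite exprMn exprVn ler_pM2r ?invr_gt0 ?exprn_gt0//; nra.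
apply: le_trans (_ : _ <= ek * (c / e ^+ 2)) _; last by rewrite ler_pM2l.
have one : 1 <= ek * (C2 / e) by rewrite mulrC -ler_pdivrMr// div1r.
apply: le_trans (_ : _ <= 2 * (C1 / e) * d ^+ 2) _.
  by rewrite ler_wpM2r ?sqr_ge0// ler_wpM2l.
have -> : ek * (c / e ^+ 2) = 2 * (C1 / e) * d ^+ 2 * (ek * (C2 / e)).
  by rewrite /c; field; rewrite gt_eqF.
rewrite ler_peMr//; apply: mulr_ge0; last exact: sqr_ge0.
by apply: mulr_ge0 => //; rewrite divr_ge0// ltW.
Qed.

(** The exponent is made at least [c + 2 |ln e|]: the factor [e^2] cancels the [e^-2] of [Lf / ek],
    and [c * expR (- c) <= 1] absorbs the constants. The threshold [expR (-1)] gives [|ln e| >= 1],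
    so additive constants fit under the logarithm. *)
Lemma strong_count (C1 C2 d e ek Lf : R) mu : 0 < C1 -> 0 < C2 -> 0 < e <= expR (-1) ->
  0 < mu -> 0 < ek -> ek^-1 <= C2 / e -> 0 < Lf -> Lf <= C1 / e ->
  let c := 3 * C1 * C2 * d ^+ 2 in
  let A := (c + 2) * Num.sqrt (C1 / mu) in
  let N := (Num.truncn (A * (Num.sqrt e)^-1 * `|ln e|)).+1 in
  3 * Lf * d ^+ 2 * expR (- (N%:R * Num.sqrt (mu / Lf))) <= ek /\
  N.+1%:R <= (A + 2) * (Num.sqrt e)^-1 * `|ln e|.
Proof.
move=> C10 C20 /andP[e0 e1] mu0 ek0 ekC Lf0 LfC c A N.
have c0 : 0 <= c by rewrite /c mulr_ge0 ?sqr_ge0// !mulr_ge0 ?ltW.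
have lne : ln e <= -1 by rewrite -[-1]expRK ler_ln ?posrE ?expR_gt0.
have ln0 : ln e <= 0 by apply: le_trans lne _; rewrite oppr_le0.
have se0 : 0 < Num.sqrt e by rewrite sqrtr_gt0.
have e_le1 : e <= 1 by rewrite (le_trans e1)// -[leRHS]expR0 ler_expR oppr_le0.
have se1 : 1 <= (Num.sqrt e)^-1.
  by rewrite invf_ge1// -[leRHS]sqrtr1 ler_wsqrtr.
have l1 : 1 <= `|ln e| by rewrite ler0_norm// lerNr.
have A0 : 0 <= A by rewrite mulr_ge0 ?addr_ge0 ?sqrtr_ge0.
have a0 : 0 <= A * (Num.sqrt e)^-1 * `|ln e|.
  by apply: mulr_ge0 => //; apply: mulr_ge0 => //; rewrite invr_ge0 ltW.
have [N1 N2] := truncn_bounds a0; rewrite -/N in N2.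
have sl1 : 1 <= (Num.sqrt e)^-1 * `|ln e| by rewrite mulr_ege1.
split; last first.
  have -> : N.+1%:R = (Num.truncn (A * (Num.sqrt e)^-1 * `|ln e|))%:R + 2 :> R.
    by rewrite /N -!natr1; ring.
  have -> : (A + 2) / Num.sqrt e * `|ln e| =
      A / Num.sqrt e * `|ln e| + 2 * ((Num.sqrt e)^-1 * `|ln e|) by ring.
  by rewrite lerD// ler_peMr.
have expo : c + 2 * `|ln e| <= N%:R * Num.sqrt (mu / Lf).
  apply: le_trans (_ : _ <= A * (Num.sqrt e)^-1 * `|ln e| * Num.sqrt (mu / Lf)) _; last first.
    by rewrite ler_wpM2r// sqrtr_ge0.
  have ge1 : 1 <= Num.sqrt (C1 / mu) * (Num.sqrt e)^-1 * Num.sqrt (mu / Lf).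
    rewrite -sqrtrV ?(ltW e0)// -!sqrtrM ?divr_ge0 ?mulr_ge0 ?invr_ge0 ?(ltW C10, ltW mu0, ltW e0)//.
    rewrite (_ : C1 / mu * e^-1 * (mu / Lf) = C1 / e / Lf); last first.
      by field; rewrite !gt_eqF.
    have : 1 <= C1 / e / Lf by rewrite ler_pdivlMr// mul1r.
    by move=> ?; rewrite -[leLHS]sqrtr1 ler_wsqrtr.
  apply: le_trans (_ : _ <= (c + 2) * `|ln e|) _; first by nra.
  have -> : A / Num.sqrt e * `|ln e| * Num.sqrt (mu / Lf) = (c + 2) * `|ln e| *
     (Num.sqrt (C1 / mu) / Num.sqrt e * Num.sqrt (mu / Lf)) by rewrite /A; ring.
  by rewrite ler_peMr// mulr_ge0// addr_ge0.
have expb : expR (- (N%:R * Num.sqrt (mu / Lf))) <= expR (- c) * e ^+ 2.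
  rewrite (_ : expR (- c) * e ^+ 2 = expR (- (c + 2 * `|ln e|))); first by rewrite ler_expR lerN2.
  rewrite ler0_norm// opprD expRD; congr (_ * _).
  by rewrite mulrN opprK expRM_natl lnK ?posrE.
have ekE : e / C2 <= ek.
  have one : 1 <= ek * (C2 / e) by rewrite mulrC -ler_pdivrMr// div1r.
  by rewrite ler_pdivrMr//; move: one; rewrite mulrA ler_pdivlMr// mul1r.
apply: le_trans ekE.
apply: le_trans (_ : _ <= 3 * (C1 / e) * d ^+ 2 * (expR (- c) * e ^+ 2)) _.
  apply: ler_pM => //; last by rewrite ler_wpM2r ?sqr_ge0// ler_wpM2l.
    by rewrite mulr_ge0 ?sqr_ge0// mulr_ge0// ltW.
have -> : 3 * (C1 / e) * d ^+ 2 * (expR (- c) * e ^+ 2) = e / C2 * (c * expR (- c)).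
  by rewrite /c; field; rewrite !gt_eqF.
rewrite ler_piMr ?divr_ge0 ?(ltW e0, ltW C20)//.
rewrite expRN ler_pdivrMr ?expR_gt0// mul1r.
by apply: le_trans (expR_ge1Dx c); rewrite lerDr.
Qed.

End Counts.

(** * Total complexity of the method *)

Section Complexity.
Context {R : realType} {n p m : nat}.
Variable P : cvxprog R n p m.
Variables (L0 : R) (L : 'I_m -> R) (mu : R).
Hypotheses (std : standing P L0 L) (hmu : modulus P L0 mu).
Variables (B : 'I_m -> R) (x0 : 'cV[R]_n).
Hypotheses (hB : fbounds P B) (dx0 : cdom P x0).

Lemma constants_ge0 : [/\ 0 <= L0, forall i, 0 <= L i &
  forall i, 0 <= B i * (B i + L i)].
Proof.
case: std => _ _ _ _ [[L00 _] hL _].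
have Li i : 0 <= L i by case: (hL i).
split=> // i; have Bi : 0 <= B i.
  by have [/(_ x0 dx0)] := hB i; rewrite ge_max => /andP[/(le_trans (normr_ge0 _))].
by rewrite mulr_ge0// addr_ge0.
Qed.

(** [e * Lphi] is at most this for [e <= 1], [beta <= Cb / e] and multipliers bounded by [M]; the
    leading [1] makes it positive. *)
Definition Lphi_const (Cb M : R) : R :=
  1 + L0 + Cb * opnorm ((cA P)^T *m cA P)
  + \sum_i (Cb * (B i * (B i + L i)) + L i * M).

Lemma Lphi_bounds Cb M e beta z : 0 <= Cb -> 0 <= M -> 0 < e <= 1 ->
  0 < beta <= Cb / e -> enorm z <= M ->
  [/\ 0 <= L0, L0 <= Lphi P L0 L B beta z, 0 < Lphi_const Cb M
    & Lphi P L0 L B beta z <= Lphi_const Cb M / e].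
Proof.
move=> Cb0 M0 /andP[e0 e1] /andP[b0 bC] zM.
have [L00 Li BL] := constants_ge0.
have op0 := opnorm_ge0 ((cA P)^T *m cA P).
split=> //.
- rewrite /Lphi -addrA lerDl addr_ge0 ?mulr_ge0 ?(ltW b0)//.
  apply: sumr_ge0 => i _; rewrite -[beta * B i * _]mulrA.
  exact: addr_ge0 (mulr_ge0 (ltW b0) (BL i)) (mulr_ge0 (Li i) (normr_ge0 _)).
- rewrite /Lphi_const -!addrA ltr_pwDl// !addr_ge0 ?mulr_ge0//.
  by apply: sumr_ge0 => i _; rewrite addr_ge0// mulr_ge0.
rewrite ler_pdivlMr// /Lphi /Lphi_const !mulrDl mulr_suml.
have be : beta * e <= Cb by rewrite -ler_pdivlMr.
apply: lerD; first apply: lerD.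
- by apply: le_trans (_ : _ <= L0) _; [rewrite ler_piMr|rewrite lerDr].
- by rewrite mulrAC ler_wpM2r.
- apply: ler_sum => i _; rewrite mulrDl; apply: lerD.
    by rewrite -[beta * B i * _]mulrA mulrAC ler_wpM2r.
  rewrite -mulrA ler_wpM2l// (le_trans _ zM)//.
  by apply: le_trans (coord_le_enorm z i); rewrite ler_piMr.
Qed.

(** The cap [Nb] depends on [e] but not on the subproblem, hence serves all [K] of them. *)
Lemma subproblem_cap (Cb C2 M : R) : 0 <= Cb -> 0 < C2 -> 0 <= M ->
  exists2 Ct : R, 0 <= Ct & forall e, 0 < e <= expR (-1) ->
  exists2 Nb : nat,
    Nb%:R <= (if mu == 0 then Ct * e^-1 else Ct * (Num.sqrt e)^-1 * `|ln e|) &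
    forall beta y z ek w0 w wh alpha, 0 < beta <= Cb / e -> enorm z <= M ->
      0 < ek -> ek^-1 <= C2 / e -> cdom P w0 ->
      nesterov_subproblem P L0 L B mu beta y z ek w0 w wh alpha ->
      ~ running (inexact_min P beta y z ek) w Nb.
Proof.
move=> Cb0 C20 M0; case: (std) => _ _ _ _ [_ _ /enorm_bounded[d d1 diam]].
have e_le1 (e : R) : 0 < e <= expR (-1) -> 0 < e <= 1.
  move=> /andP[-> e1] /=; apply: le_trans e1 _.
  by apply: (@le_trans _ _ (expR 0)); [rewrite ler_expR oppr_le0|rewrite expR0].
pose C1 := Lphi_const Cb M.
have C10 : 0 <= C1.
  have [L00 Li BL] := constants_ge0.
  rewrite /C1 /Lphi_const !addr_ge0 ?mulr_ge0 ?opnorm_ge0//.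
  by apply: sumr_ge0 => i _; rewrite addr_ge0// mulr_ge0.
case: (hmu) => [mu0|[/andP[mu_gt0 muL] _]].
  exists (2 + 2 * C1 * C2 * d ^+ 2).
    by rewrite addr_ge0// mulr_ge0 ?sqr_ge0// !mulr_ge0// ltW.
  move=> e e01.
  exists (Num.truncn ((1 + 2 * C1 * C2 * d ^+ 2) / e)).+1.
    rewrite mu0 eqxx.
    have /andP[e0 _] := e01.
    (* The bound on the count mentions neither [ek] nor [Lf], so it is read off at the extreme
       values [e / C2] and [C1 / e]. *)
    have ek0 : 0 < e / C2 by rewrite divr_gt0.
    have ekC : (e / C2)^-1 <= C2 / e by rewrite invf_div.
    have Lf0 : 0 <= C1 / e by rewrite divr_ge0// ltW.
    by have [] := convex_count d C10 (ltW C20) (e_le1 _ e01) ek0 ekC Lf0 (lexx _).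
  move=> beta y z ek w0 w wh alpha bC zM ek0 ekC dw0 sub.
  have [L00 LL C1gt LC] := Lphi_bounds Cb0 M0 (e_le1 _ e01) bC zM.
  have Lf0 := le_trans L00 LL.
  have [rate _] := convex_count d C10 (ltW C20) (e_le1 _ e01) ek0 ekC Lf0 LC.
  have b0 : 0 < beta by case/andP: bC.
  exact: (convex_subproblem_stop std hmu b0 dw0 sub diam mu0 Lf0 rate).
exists ((3 * (C1 + 1) * C2 * d ^+ 2 + 2) * Num.sqrt ((C1 + 1) / mu) + 2).
  apply: addr_ge0 => //; apply: mulr_ge0 (sqrtr_ge0 _); apply: addr_ge0 => //.
  apply: mulr_ge0 (sqr_ge0 _); apply: mulr_ge0 (ltW C20).
  by apply: mulr_ge0 => //; exact: addr_ge0.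
have C1p : 0 < C1 + 1 by rewrite ltr_wpDl.
move=> e e01; have /andP[e0 _] := e01.
(* The witness is fixed by unification with the number in [strong_count]. *)
eexists; last first.
  move=> beta y z ek w0 w wh alpha bC zM ek0 ekC dw0 sub.
  have [L00 LL _ LC] := Lphi_bounds Cb0 M0 (e_le1 _ e01) bC zM.
  have mLf : mu < Lphi P L0 L B beta z by apply: lt_le_trans LL; lra.
  have Lf0 : 0 < Lphi P L0 L B beta z by exact: lt_trans mLf.
  have LC' : Lphi P L0 L B beta z <= (C1 + 1) / e.
    by apply: le_trans LC _; rewrite ler_pM2r ?invr_gt0// lerDl.
  have [rate _] := strong_count d C1p C20 e01 mu_gt0 ek0 ekC Lf0 LC'.
  have b0 : 0 < beta by case/andP: bC.
  have mL : 0 < mu < Lphi P L0 L B beta z by rewrite mu_gt0.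
  exact: (strong_subproblem_stop std hmu b0 dw0 sub diam mL rate).
rewrite (gt_eqF mu_gt0).
have ek0 : 0 < e / C2 by rewrite divr_gt0.
have ekC : (e / C2)^-1 <= C2 / e by rewrite invf_div.
have Lf0 : 0 < (C1 + 1) / e by rewrite divr_gt0.
by have [] := strong_count d C1p C20 e01 mu_gt0 ek0 ekC Lf0 (lexx _).
Qed.

(** No circularity: the bound on [z k], hence the cap for subproblem [k], relies only on the
    subproblems before [k] being solved, so termination is part of the conclusion. *)
Lemma iteration_bound (xs : 'cV[R]_n) (ys : 'cV[R]_p) (zs : 'cV[R]_m)
    (K : nat) (Cb Ce sigma : R) :
  kkt P xs ys zs -> (0 < K)%N -> 0 < Cb -> 0 < Ce -> 1 < sigma ->
  exists C e0 : R, 0 < e0 /\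
  forall (e : R) (rho beta epss : nat -> R) (x : nat -> 'cV[R]_n)
    (y : nat -> 'cV[R]_p) (z : nat -> 'cV[R]_m)
    (w wh : nat -> nat -> 'cV[R]_n) (alpha : nat -> nat -> R)
    (T : nat -> nat) (k : nat),
  0 < e <= e0 ->
  setting1 K Cb Ce e rho beta epss \/
    setting2 K Cb Ce sigma e rho beta epss \/
    setting3 K Cb Ce sigma mu e rho beta epss ->
  x 0%N = x0 -> y 0%N = 0 -> z 0%N = 0 -> (k < K)%N ->
  (forall j, (j <= k)%N ->
     nesterov_subproblem P L0 L B mu (beta j) (y j) (z j) (epss j)
       (x j) (w j) (wh j) (alpha j)) ->
  (forall j, (j < k)%N ->
     [/\ stops_at (inexact_min P (beta j) (y j) (z j) (epss j))
           (w j) (T j),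
         x j.+1 = w j (T j)
       & dual_step P (rho j) (beta j) (x j.+1)
           (y j) (z j) (y j.+1) (z j.+1)]) ->
  exists2 t : nat,
    stops_at (inexact_min P (beta k) (y k) (z k) (epss k)) (w k) t
    & (\sum_(j < k) T j + t)%N%:R <=
        (if mu == 0 then C * e^-1 else C * (Num.sqrt e)^-1 * `|ln e|).
Proof.
move=> hkkt K0 Cb0 Ce0 s1.
have KR : 0 < K%:R :> R by rewrite ltr0n.
have C20 : 0 < 2 * K%:R * Cb / Ce by rewrite divr_gt0// !mulr_gt0.
have [Ct Ct0 cap] := subproblem_cap (ltW Cb0) C20 (dual_bound_ge0 ys zs Ce0).
exists (K%:R * Ct), (expR (-1)); split; first exact: expR_gt0.
move=> e rho beta epss x y z w wh alpha T k e01 set_ x0E y0 z0 kK sub prev.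
have /andP[e0 _] := e01.
have ws := setting_well_set K0 Cb0 Ce0 s1 e0 set_.
have [Nb NbC nrun] := cap e e01.
have steps : ialm_steps P beta epss x y z k.
  move=> j jk; have [[acc _] xE ds] := prev j jk.
  case: ws => /(_ j (ltn_trans jk kK)) [rE b0 _ _ _] _ _.
  by split=> //; [rewrite xE|rewrite -[X in dual_step _ X]rE].
have nrunj j : (j <= k)%N ->
    ~ running (inexact_min P (beta j) (y j) (z j) (epss j)) (w j) Nb.
  move=> jk; have jK := leq_ltn_trans jk kK.
  have stepsj : ialm_steps P beta epss x y z j.
    by move=> i ij; apply: steps; exact: leq_trans jk.
  have [_ zM] := steps_dual_bound std hkkt Ce0 ws y0 z0 (ltnW jK) stepsj.
  case: (ws) => /(_ j jK) [_ b0 bC ep0 epC] _ _.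
  apply: (nrun _ _ _ _ _ _ _ _ _ zM ep0 _ _ (sub j jk)).
  - by rewrite b0.
  - by apply: le_trans epC _; rewrite invfM mulrA.
  (* The warm start is [x0] or an earlier approximate minimizer, both in the domain. *)
  - case: j jk {jK zM b0 bC ep0 epC} stepsj => [|j] jk stepsj; first by rewrite x0E.
    exact: (ialm_dom std hkkt stepsj (leqnn _)).
have [t st] := stops_at_exists (nrunj k (leqnn k)).
exists t => //.
have leN : (\sum_(j < k) T j + t <= K * Nb)%N.
  apply: leq_trans (_ : (k.+1 * Nb <= _)%N); last by rewrite leq_mul2r kK orbT.
  rewrite mulSn addnC leq_add//; first exact: stops_at_bound (nrunj k _) st.
  rewrite -[k in (k * _)%N]card_ord -sum_nat_const leq_sum// => j _.
  have [stj _ _] := prev j (ltn_ord j).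
  exact: stops_at_bound (nrunj j (ltnW (ltn_ord j))) stj.
apply: le_trans (_ : _ <= (K * Nb)%N%:R) _; first by rewrite ler_nat.
rewrite natrM; move: NbC; case: ifP => _ NbC; rewrite -!mulrA ler_pM2l// mulrA//.
Qed.

End Complexity.

(** [ca] and [cb] are chosen before [n] and [P]: this expresses that the hidden constants depend
    only on their arguments. *)
Theorem theorem1 (R : realType) (p m : nat) :
  exists (ca : R -> R -> 'cV[R]_p -> 'cV[R]_m -> R)
         (cb : R -> R -> R -> 'cV[R]_p -> 'cV[R]_m -> R),
  forall (n : nat) (P : cvxprog R n p m) (L0 : R) (L : 'I_m -> R) (mu : R)
    (xs : 'cV[R]_n) (ys : 'cV[R]_p) (zs : 'cV[R]_m)
    (K : nat) (Cb Ce sigma : R),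
  standing P L0 L -> modulus P L0 mu -> kkt P xs ys zs ->
  (0 < K)%N -> 0 < Cb -> 0 < Ce -> 1 < sigma ->
  [/\ (* (a) *)
      forall (e : R) (rho beta epss : nat -> R) (x : nat -> 'cV[R]_n)
        (y : nat -> 'cV[R]_p) (z : nat -> 'cV[R]_m),
      0 < e ->
      setting1 K Cb Ce e rho beta epss \/
        setting2 K Cb Ce sigma e rho beta epss \/
        setting3 K Cb Ce sigma mu e rho beta epss ->
      ialm P K rho beta epss x y z -> y 0%N = 0 -> z 0%N = 0 ->
      eps_optimal P (ca Cb Ce ys zs * e) (avg_point K rho x),
      (* (b) *)
      p = 0%N ->
      forall (e : R) (rho beta epss : nat -> R) (x : nat -> 'cV[R]_n)
        (y : nat -> 'cV[R]_p) (z : nat -> 'cV[R]_m),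
      0 < e ->
      setting2 K Cb Ce sigma e rho beta epss \/
        setting3 K Cb Ce sigma mu e rho beta epss ->
      ialm P K rho beta epss x y z -> y 0%N = 0 -> z 0%N = 0 ->
      eps_optimal P (cb Cb Ce sigma ys zs * e) (x K)
    & (* (c) *)
      forall (B : 'I_m -> R) (x0 : 'cV[R]_n),
      fbounds P B -> cdom P x0 ->
      exists C e0 : R, 0 < e0 /\
      forall (e : R) (rho beta epss : nat -> R) (x : nat -> 'cV[R]_n)
        (y : nat -> 'cV[R]_p) (z : nat -> 'cV[R]_m)
        (w wh : nat -> nat -> 'cV[R]_n) (alpha : nat -> nat -> R)
        (T : nat -> nat) (k : nat),
      0 < e <= e0 ->
      setting1 K Cb Ce e rho beta epss \/
        setting2 K Cb Ce sigma e rho beta epss \/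
        setting3 K Cb Ce sigma mu e rho beta epss ->
      x 0%N = x0 -> y 0%N = 0 -> z 0%N = 0 -> (k < K)%N ->
      (* subproblems 0, ..., k-1 have been solved with T 0, ..., T k.-1
         iterations and subproblem k is being solved *)
      (forall j, (j <= k)%N ->
         nesterov_subproblem P L0 L B mu (beta j) (y j) (z j) (epss j)
           (x j) (w j) (wh j) (alpha j)) ->
      (forall j, (j < k)%N ->
         [/\ stops_at (inexact_min P (beta j) (y j) (z j) (epss j))
               (w j) (T j),
             x j.+1 = w j (T j)
           & dual_step P (rho j) (beta j) (x j.+1)
               (y j) (z j) (y j.+1) (z j.+1)]) ->
      (* subproblem k is solved as well, and the count so far is bounded *)
      exists2 t : nat,
        stops_at (inexact_min P (beta k) (y k) (z k) (epss k)) (w k) t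
        & (\sum_(j < k) T j + t)%N%:R <=
            (if mu == 0 then C * e^-1 else C * (Num.sqrt e)^-1 * `|ln e|)].
Proof.
pose M := fun (Ce : R) (ys : 'cV[R]_p) (zs : 'cV[R]_m) => dual_bound ys zs Ce.
exists (fun Cb Ce ys zs => Ce / (2 * Cb) + 2 * M Ce ys zs / Cb * (1 + enorm ys + enorm zs)).
exists (fun Cb Ce sigma ys zs => sigma / (sigma - 1) / Cb *
  (Ce + M Ce ys zs ^+ 2 + 3 * M Ce ys zs * (1 + enorm ys + enorm zs))).
move=> n P L0 L mu xs ys zs K Cb Ce sigma std hmu hkkt K0 Cb0 Ce0 s1; split.
- move=> e rho beta epss x y z e0 set_ run y0 z0.
  have ws := setting_well_set K0 Cb0 Ce0 s1 e0 set_.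
  exact: (average_eps_optimal std hkkt Cb0 Ce0 e0 ws y0 z0 run K0).
- move=> _ e rho beta epss x y z e0 set_ run y0 z0.
  have ws := setting_well_set K0 Cb0 Ce0 s1 e0 (or_intror set_).
  have geo : Defs.geometric K Cb sigma e rho beta by case: set_ => -[].
  have [_ _ last] := geometric_facts Cb0 e0 s1 geo.
  have KE : K = K.-1.+1 by rewrite prednK.
  apply: (last_eps_optimal std hkkt Ce0 e0 ws y0 z0 run KE).
    apply: le_trans (last _ KE) _; rewrite le_eqVlt; apply/orP; left; apply/eqP.
    by field; rewrite !gt_eqF ?subr_gt0.
  by rewrite !divr_ge0 ?(ltW Cb0)// ?subr_ge0 ltW// (lt_trans ltr01).
- move=> B x0 hB dx0.
  exact: (iteration_bound std hmu hB dx0 hkkt K0 Cb0 Ce0 s1).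
Qed.
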